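(* For every integer $n\ge 2$, the generalized associahedron $D^n$ of type $D_n$ lies in the set $\mathscr{P}^{\mathrm{cube}}$; that is, $D^n$ is combinatorially equivalent to a polytope obtained from the standard cube $I^n$ by successively shaving off faces of codimension $2$.
   Context: Polytopes are convex and considered up to combinatorial equivalence (isomorphism of face lattices). A polytope of dimension $n$ is simple if each of its vertices is contained in precisely $n$ facets. A simple polytope is called flag if any set of pairwise intersecting facets has a non-empty common intersection; the combinatorial type of a flag polytope is determined by which pairs of its facets intersect. The polytope $D^n$: the generalized associahedron $D^n$ is the $n$-dimensional simple flag polytope dual to the cluster complex of the finite type cluster algebra with Dynkin diagram $D_n$ (with the conventions $D_2=A_1\sqcup A_1$, $D_3=A_3$). Combinatorially it is described as follows. Take a regular $2n$-gon. The set of facets of $D^n$ is in bijection with $Diag \cup D \cup D'$ (disjoint union), where $Diag$ is the set of unordered pairs of mutually centrally symmetric diagonals of the $2n$-gon that are not diameters (a diameter is a diagonal joining two antipodal vertices), and $D$ and $D'$ are two copies of the set of the $n$ diameters, those in $D$ coloured in one colour and those in $D'$ in another colour. Two distinct facets intersect if and only if one of the following holds: (1) at least one of the two corresponds to an element of $Diag$, and no diagonal belonging to the first facet has a common interior point with a diagonal belonging to the second; (2) they correspond to two diameters of the same colour; (3) they correspond to two diameters of different colours connecting the same pair of antipodal vertices. Shaving: for a simple polytope $P$ and a proper face $G$ of $P$, shaving off $G$ means intersecting $P$ with a closed half-space whose bounding hyperplane contains no vertex of $P$ and whose complement contains exactly those vertices of $P$ that belong to $G$. The result is again a simple polytope,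 with combinatorial type depending only on $P$ and $G$. $\mathscr{P}^{\mathrm{cube}}$ is the set of (combinatorial types of) polytopes obtained from a standard cube $I^n=[0,1]^n$ by a finite (possibly empty) sequence of shavings of faces of codimension $2$, where each shaved face is a face of the polytope obtained at the previous step. *)

(* Defs.v *)
From mathcomp Require Import all_boot all_order all_algebra.
From mathcomp Require Import all_classical all_reals all_analysis.

Set Implicit Arguments.
Unset Strict Implicit.
Unset Printing Implicit Defensive.

Import Order.TTheory GRing.Theory Num.Theory.

Local Open Scope ring_scope.

(* Diagonals of the regular 2n-gon, whose vertices are labelled cyclically by
   'I_n.*2; a segment joining two vertices is the set of its endpoints. *)
Section Diagonals.

Variable n : nat.

Definition antipode (i : 'I_n.*2) : 'I_n.*2 := iter n (@ordS n.*2) i.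

Definition is_side (A : {set 'I_n.*2}) : bool :=
  [exists i, A == [set i; ordS i]%SET].

Definition diagonals : {set {set 'I_n.*2}} :=
  [set A : {set 'I_n.*2} | (#|A| == 2%N) && ~~ is_side A]%SET.

Definition diameters : {set {set 'I_n.*2}} :=
  [set A in diagonals | [exists i, A == [set i; antipode i]%SET]]%SET.

Definition central_image (A : {set 'I_n.*2}) : {set 'I_n.*2} :=
  (antipode @: A)%SET.

Definition Diag : {set {set {set 'I_n.*2}}} :=
  [set [set A; central_image A] | A in diagonals :\: diameters]%SET.

(* Diag + D + D'; the boolean is the colour of a diameter. *)
Definition Dlabel : Type :=
  ({p | p \in Diag} + {d | d \in diameters} * bool)%type.

Definition label_diagonals (x : Dlabel) : {set {set 'I_n.*2}} :=
  match x with
  | inl p => val p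
  | inr (d, _) => [set val d]%SET
  end.

Definition in_Diag (x : Dlabel) : bool := if x is inl _ then true else false.

End Diagonals.

Local Open Scope classical_set_scope.
Local Open Scope card_scope.

Section PolygonGeometry.

Variables (R : realType) (n : nat).

Definition polygon_vertex (i : 'I_n.*2) : 'rV[R]_2 :=
  let t := pi * i%:R / n%:R in
  \row_(k < 2) (if k == 0 then cos t else sin t).

Definition diagonal_interior (A : {set 'I_n.*2}) : set 'rV[R]_2 :=
  [set z | exists i j t, [/\ A = [set i; j]%SET, i != j, 0 < t < 1 &
    z = (1 - t) *: polygon_vertex i + t *: polygon_vertex j]].

Definition Dcompatible (x y : Dlabel n) : Prop :=
  [\/ (in_Diag x || in_Diag y) /\
      (forall A B, A \in label_diagonals x -> B \in label_diagonals y ->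
         diagonal_interior A `&` diagonal_interior B = set0),
      (exists d e c, [/\ x = inr (d, c) & y = inr (e, c)]) |
      (exists d c c', [/\ x = inr (d, c), y = inr (d, c') & c != c'])].

End PolygonGeometry.

Section Polytopes.

Variable R : realType.

(* The linear form on row vectors with coefficient vector a. *)
Definition linform m (a : 'cV[R]_m) (x : 'rV[R]_m) : R := (x *m a) 0 0.

Definition polytope m (P : set 'rV[R]_m) : Prop :=
  (exists k (A : 'I_k -> 'cV[R]_m) (b : 'I_k -> R),
     P = [set x | forall i, linform (A i) x <= b i]) /\
  (exists M : R, forall x, P x -> forall j, `|x 0 j| <= M).

(* Both the empty set and P itself are faces of P. *)
Definition face m (P F : set 'rV[R]_m) : Prop :=
  exists (a : 'cV[R]_m) (c : R),
    (forall x, P x -> linform a x <= c) /\ F = P `&` [set x | linform a x = c].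

(* The dimension of a nonempty set is the rank of the direction space U of its
   affine hull, i.e. of the smallest subspace containing all differences of
   points of the set. *)
Definition has_dim m (F : set 'rV[R]_m) (d : nat) : Prop :=
  F !=set0 /\
  exists U : 'M[R]_m,
    [/\ \rank U = d,
        forall x y, F x -> F y -> (x - y <= U)%MS &
        forall W : 'M[R]_m,
          (forall x y, F x -> F y -> (x - y <= W)%MS) -> (U <= W)%MS].

Definition codim_face m (P : set 'rV[R]_m) (k : nat) (F : set 'rV[R]_m) : Prop :=
  face P F /\ exists d, has_dim P (d + k)%N /\ has_dim F d.

Definition facet m (P F : set 'rV[R]_m) : Prop := codim_face P 1 F.

Definition vertex m (P : set 'rV[R]_m) (v : 'rV[R]_m) : Prop := face P [set v].

Definition simple_polytope m (P : set 'rV[R]_m) (n : nat) : Prop :=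
  [/\ polytope P, has_dim P n &
      forall v, vertex P v -> [set F | facet P F /\ F v] #= `I_n].

Definition flag_polytope m (P : set 'rV[R]_m) (n : nat) : Prop :=
  simple_polytope P n /\
  forall S : set (set 'rV[R]_m), S `<=` facet P ->
    (forall F G, S F -> S G -> F `&` G !=set0) ->
    \bigcap_(F in S) F !=set0.

Definition comb_equiv m1 m2 (P : set 'rV[R]_m1) (Q : set 'rV[R]_m2) : Prop :=
  exists f : set 'rV[R]_m1 -> set 'rV[R]_m2,
    set_bij (face P) (face Q) f /\
    forall F G, face P F -> face P G -> (F `<=` G <-> f F `<=` f G).

(* Q is obtained from P by shaving off the face G. *)
Definition shaving m (P G Q : set 'rV[R]_m) : Prop :=
  exists (a : 'cV[R]_m) (c : R),
    [/\ a != 0,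
        forall v, vertex P v -> linform a v != c,
        forall v, vertex P v -> (c < linform a v <-> G v) &
        Q = P `&` [set x | linform a x <= c]].

Definition std_cube n : set 'rV[R]_n := [set x | forall i, 0 <= x 0 i <= 1].

Inductive cube_shaved n : set 'rV[R]_n -> Prop :=
| cube_shaved_cube : cube_shaved (@std_cube n)
| cube_shaved_step P G Q :
    cube_shaved P -> codim_face P 2 G -> shaving P G Q -> cube_shaved Q.

Definition Pcube n (P : set 'rV[R]_n) : Prop :=
  polytope P /\ exists Q : set 'rV[R]_n, cube_shaved Q /\ comb_equiv P Q.

(* P is a realization in R^n of the generalized associahedron D^n. *)
Definition assoc_D n (P : set 'rV[R]_n) : Prop :=
  flag_polytope P n /\
  exists phi : Dlabel n -> set 'rV[R]_n,
    set_bij [set: Dlabel n] (facet P) phi /\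
    forall x y, x <> y ->
      (phi x `&` phi y !=set0 <-> Dcompatible R x y).

End Polytopes.

(* Main.v *)
Require Import Defs.
From mathcomp Require Import all_boot all_order all_algebra.
From mathcomp Require Import all_classical all_reals all_analysis.
From mathcomp Require Import ring lra zify.

Set Implicit Arguments.
Unset Strict Implicit.
Unset Printing Implicit Defensive.

Import Order.TTheory GRing.Theory Num.Theory.

Local Open Scope ring_scope.
Local Open Scope classical_set_scope.
Local Open Scope card_scope.

(** Consider the [n ^ 2] facets of [D^n] as arcs and diameters.  An orbit of
    non-diametral diagonals has a representative joining vertex [i] to vertex
    [i + l] of the [2n]-gon with [i < n] and [2 <= l < n]; it is the arc of
    length [l] leaving [i], and its target is [i + l] modulo [n].  Write [(i,+)]
    and [(i,-)] for the two coloured copies of the [i]-th diameter.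

    Among diameters, [(i,+)] and [(j,-)] with [i <> j] are disjoint facets of
    [D^n].  There are [n (n - 1)] such pairs and [n (n - 2)] arcs, and the arc of
    length [l] leaving [i] is naturally paired with [(i,+)], [(i + l,-)].  The
    pairs that remain are [(i,+)], [(i + 1,-)]: if they were the only disjoint
    ones, the diameters would be the facets of a cube, a pair being two opposite
    facets.  This suggests to start from the cube and to create the arcs by
    increasing length, the arc of length [l] leaving [i] being the new facet
    obtained by shaving [(i,+)] /\ [(i + l,-)].

    Shaving [F /\ G] off a simple flag polytope gives a simple flag polytope in
    which [F] and [G] are disjoint, and whose new facet meets exactly [F], [G]
    and the facets that met both [F] and [G].  So what has to be checked is that
    the facets met by an arc [w] of length [l] are, apart from its two diameters,
    those that meet both of these diameters at the time when only the arcs of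
    smaller length, and possibly some of length [l], are present
    ([label_step_new]).  For an arc of length at most [l] this says that it
    crosses [w] exactly when it passes over an endpoint of [w]; indeed, to pass
    over an endpoint without crossing, it would have to contain [w] and be
    longer.  For a diameter [(j,-)], to meet
    [(i,+)] at that time means that [j] is not at distance between [1] and
    [l - 1] after [i], that is, not strictly under [w].

    On the geometric side, the combinatorics is carried by [realizes]: a bounded
    set of solutions of inequalities indexed by labels, whose tight inequalities
    are linearly independent at each point, and in which a set of inequalities
    can be simultaneously tight exactly when the labels are pairwise adjacent.
    Such a set is a simple flag polytope, and its faces are determined by the
    graph, so two of them with the same graph are combinatorially equivalent
    ([realizes_comb_equiv]).  Shaving transforms such a presentation into another
    one ([realizes_shaving]), and every flag polytope has one
    ([flag_realizes]).  Finally two diagonals of the regular polygon have a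
    common interior point exactly when their endpoints alternate
    ([diagonals_disjoint]), which identifies the graph of [D^n] with the graph on
    arcs and diameters ([to_Dlabel_compatible]). *)

Lemma exists_argmin (T : Type) (P : set T) (f : T -> nat) :
  P !=set0 -> exists x, P x /\ forall y, P y -> (f x <= f y)%N.
Proof.
move=> [x0 Px0].
have exP : exists k, `[< exists2 x, P x & f x = k >].
  by exists (f x0); apply/asboolP; exists x0.
case: (ex_minnP exP) => m /asboolP[x Px <-] mP.
by exists x; split=> // y Py; apply/mP/asboolP; exists y.
Qed.

Lemma exists_argmax (T : Type) (P : set T) (f : T -> nat) (B : nat) :
  (forall x, P x -> (f x <= B)%N) ->
  P !=set0 -> exists x, P x /\ forall y, P y -> (f y <= f x)%N.
Proof.
move=> fB P0; have [x [Px xmin]] := exists_argmin (fun y => B - f y)%N P0.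
by exists x; split=> // y Py; have := xmin _ Py; have := fB _ Py; have := fB _ Px; lia.
Qed.

Lemma exists_small (R : realType) (I : finType) (Q : I -> R -> Prop) :
  (forall i, exists2 e, 0 < e & forall s, 0 <= s <= e -> Q i s) ->
  exists2 e, 0 < e & forall i s, 0 <= s <= e -> Q i s.
Proof.
move=> h; have {h} /choice[e eP] : forall i, exists e, 0 < e /\
    forall s, 0 <= s <= e -> Q i s by move=> i; have [e] := h i; exists e.
exists (\big[Num.min/1]_i e i); first by apply/lt_bigmin => // i _; case: (eP i).
move=> i s /andP[s0 se]; apply: (eP i).2.
by rewrite s0 (le_trans se)// bigmin_le.
Qed.

(** * Polyhedra given by inequalities *)

Section LinearForms.

Variables (R : realType) (n : nat).
Implicit Types (a : 'cV[R]_n) (x y d : 'rV[R]_n).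

Lemma linformD a x y : linform a (x + y) = linform a x + linform a y.
Proof. by rewrite /linform mulmxDl mxE. Qed.

Lemma linformZ a s x : linform a (s *: x) = s * linform a x.
Proof. by rewrite /linform -scalemxAl mxE. Qed.

Lemma linformN a x : linform a (- x) = - linform a x.
Proof. by rewrite -scaleN1r linformZ mulN1r. Qed.

Lemma linformB a x y : linform a (x - y) = linform a x - linform a y.
Proof. by rewrite linformD linformN. Qed.

Lemma linform_addl a a' x : linform (a + a') x = linform a x + linform a' x.
Proof. by rewrite /linform mulmxDr mxE. Qed.

Lemma linform_suml (I : Type) (r : seq I) (p : pred I) (A : I -> 'cV[R]_n) x :
  linform (\sum_(i <- r | p i) A i) x = \sum_(i <- r | p i) linform (A i) x.
Proof. by rewrite /linform mulmx_sumr summxE. Qed.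

Lemma linform0l x : linform 0 x = 0.
Proof. by rewrite /linform mulmx0 mxE. Qed.

Definition linformE := (linformD, linformN, linformZ, linform_addl, linform0l).

Lemma ker1P a d : (d <= kermx a)%MS <-> linform a d = 0.
Proof.
rewrite /linform; split=> [/sub_kermxP->|d0]; first by rewrite mxE.
by apply/sub_kermxP/matrixP => i j; rewrite !ord1 d0 mxE.
Qed.

Lemma rank_ker1 a : a != 0 -> \rank (kermx a) = n.-1.
Proof.
move=> a0; rewrite mxrank_ker -mxrank_tr rank_rV.
have [/(congr1 trmx)|_] := eqVneq a^T 0; last by rewrite subn1.
by rewrite trmxK trmx0 => /eqP; rewrite (negPf a0).
Qed.

End LinearForms.

Section Dimension.

Variables (R : realType) (n : nat).
Implicit Types (F : set 'rV[R]_n) (x y d : 'rV[R]_n) (U : 'M[R]_n).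

Lemma has_dimP F U x : F x ->
  (forall y z, F y -> F z -> (y - z <= U)%MS) ->
  (forall d, (d <= U)%MS -> exists2 e : R, e != 0 & F (x + e *: d)) ->
  has_dim F (\rank U).
Proof.
move=> Fx FU UF; split; first by exists x.
exists U; split=> // W FW; apply/row_subP => i.
have [e e0 Fe] := UF _ (row_sub i U).
by have := FW _ _ Fe Fx; rewrite addrAC subrr add0r (eqmx_scale _ e0).
Qed.

Lemma has_dim_uniq F k k' : has_dim F k -> has_dim F k' -> k = k'.
Proof.
move=> [_ [U [<- FU Umin]]] [_ [V [<- FV Vmin]]].
by apply/eqP; rewrite eqn_leq !mxrankS ?Umin ?Vmin.
Qed.

End Dimension.

Section Halfspaces.

Variables (R : realType) (n : nat) (L : finType).
Implicit Types (x y d : 'rV[R]_n) (a : 'cV[R]_n) (J : {set L}).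

Section Presentation.

Variables (S : {set L}) (A : L -> 'cV[R]_n) (b : L -> R).

Definition Hpoly : set 'rV[R]_n :=
  [set x | forall i, i \in S -> linform (A i) x <= b i].

Definition tight x : {set L} := [set i in S | linform (A i) x == b i]%SET.

Definition Hface J : set 'rV[R]_n :=
  [set x | Hpoly x /\ forall i, i \in J -> linform (A i) x = b i].

Lemma tightP x i : reflect (i \in S /\ linform (A i) x = b i) (i \in tight x).
Proof. by rewrite inE; apply: (iffP andP) => -[? /eqP]. Qed.

Lemma slack x i : Hpoly x -> i \in S -> i \notin tight x -> linform (A i) x < b i.
Proof. by move=> Px iS; rewrite inE iS /= lt_neqAle (Px i iS) andbT. Qed.

Lemma HfaceE J x : J \subset S -> Hface J x <-> Hpoly x /\ J \subset tight x.
Proof.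
move=> JS; split=> -[Px Jx]; split=> //.
  by apply/fintype.subsetP => i iJ; apply/tightP; split; [exact: (fintype.subsetP JS)|exact: Jx].
by move=> i iJ; have /tightP[] := fintype.subsetP Jx _ iJ.
Qed.

Lemma Hpoly_move x d : Hpoly x ->
  (forall i, i \in tight x -> linform (A i) d <= 0) ->
  exists2 e, 0 < e & forall s, 0 <= s <= e -> Hpoly (x + s *: d).
Proof.
move=> Px dle.
pose Q i (s : R) := i \in S -> linform (A i) (x + s *: d) <= b i.
suff [e e0 eQ] : exists2 e, 0 < e & forall i s, 0 <= s <= e -> Q i s.
  by exists e => // s se i iS; exact: (eQ i s se iS).
apply: exists_small => i.
have [iS|iS] := boolP (i \in S); last by exists 1 => // s _; rewrite /Q (negPf iS).
have [Ad|Ad] := leP (linform (A i) d) 0.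
  exists 1 => // s /andP[s0 _] _; rewrite !linformE.
  by rewrite (le_trans _ (Px i iS))// gerDl mulr_ge0_le0.
have it : i \notin tight x by apply/negP => /dle; rewrite leNgt Ad.
have sl := slack Px iS it.
exists ((b i - linform (A i) x) / linform (A i) d).
  by rewrite divr_gt0// subr_gt0.
move=> s /andP[_]; rewrite ler_pdivlMr// => se _; rewrite !linformE.
by rewrite -lerBrDl.
Qed.

Lemma Hpoly_conv x y (s : R) : Hpoly x -> Hpoly y -> 0 <= s <= 1 ->
  Hpoly (x + s *: (y - x)).
Proof.
move=> Px Py s01 i iS; rewrite !linformE.
by have := Px i iS; have := Py i iS; nra.
Qed.

(** A point with the fewest tight inequalities is in the relative interior:
    an inequality tight at [x] but not at [y] would be slack at the midpoint. *)
Lemma exists_relint F : F `<=` Hpoly -> F !=set0 ->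
  (forall x y (s : R), F x -> F y -> 0 <= s <= 1 -> F (x + s *: (y - x))) ->
  exists2 x, F x & forall y, F y -> tight x \subset tight y.
Proof.
move=> FP F0 Fconv; have [x [Fx xmin]] := exists_argmin (fun x => #|tight x|) F0.
exists x => // y Fy.
have half : 0 <= (2^-1 : R) <= 1 by rewrite invr_ge0 ler0n invf_le1 ?ler1n ?ltr0n.
have Fz := Fconv x y _ Fx Fy half; set z := x + _ in Fz.
have zxy i : i \in tight z -> (i \in tight x) && (i \in tight y).
  move=> /tightP[iS]; rewrite !linformE => zi.
  have := FP _ Fx i iS; have := FP _ Fy i iS => yi xi.
  by apply/andP; split; apply/tightP; split=> //; lra.
have zx : tight z \subset tight x by apply/fintype.subsetP => i /zxy/andP[].
have /eqP <- : tight z == tight x by rewrite eqEcard zx xmin.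
by apply/fintype.subsetP => i /zxy/andP[].
Qed.

(** A face is cut out by the inequalities that are tight at a point [x] of its
    relative interior.  If [y] satisfies these equalities, then one can leave
    [x] a little in the direction opposite to [y] without leaving the
    polyhedron; a linear form maximal at [x] is therefore as large at [y]. *)
Lemma faceP F : face Hpoly F -> F !=set0 ->
  exists x J, [/\ F x, tight x = J & F = Hface J].
Proof.
move=> [a [c [Pc FE]]] F0.
have [||x Fx xmin] := @exists_relint F _ F0; first by rewrite FE => ? [].
  move=> x y s; rewrite FE => -[Px xc] [Py yc] s01; split; first exact: Hpoly_conv.
  by move: xc yc; rewrite /= !linformE => -> ->; rewrite subrr mulr0 addr0.
exists x, (tight x); split=> //; apply/seteqP; split=> y.
  move=> Fy; apply/HfaceE; first by apply/fintype.subsetP => i /tightP[].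
  by split; [move: Fy; rewrite FE => -[]|exact: xmin].
move=> [Py yt]; rewrite FE; split=> //=; apply/eqP; rewrite eq_le Pc//=.
move: Fx; rewrite FE => -[Px /= xc].
have [i /tightP[iS ix]|e e0 eP] := @Hpoly_move x (x - y) Px.
  by rewrite !linformE ix yt ?subrr//; apply/tightP.
have ee : 0 <= e <= e by rewrite lexx ltW.
have := Pc _ (eP e ee); rewrite !linformE xc gerDl pmulr_rle0// subr_le0.
by [].
Qed.

Lemma face_Hface J : J \subset S -> face Hpoly (Hface J).
Proof.
move=> JS; exists (\sum_(i in J) A i), (\sum_(i in J) b i).
have le x : Hpoly x -> forall i, i \in J -> linform (A i) x <= b i.
  by move=> Px i iJ; apply: Px; exact: (fintype.subsetP JS).
split=> [x Px|]; first by rewrite linform_suml; apply: ler_sum => i; exact: le.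
apply/seteqP; split=> x [Px xJ]; split=> //=.
  by rewrite linform_suml; apply: eq_bigr => i; exact: xJ.
move=> i iJ; apply/eqP; rewrite eq_le le//=.
move: xJ; rewrite /= linform_suml (bigD1 i)// [in RHS](bigD1 i)//= => E.
have : \sum_(j in J | j != i) linform (A j) x <= \sum_(j in J | j != i) b j.
  by apply: ler_sum => j /andP[jJ _]; exact: le.
by move: E; lra.
Qed.

Definition bounded (P : set 'rV[R]_n) := exists M : R, forall x, P x -> forall j, `|x 0 j| <= M.

(** The simplex method: as long as the tight inequalities leave a direction
    free, move along it without decreasing [a]; boundedness forces a new
    inequality to become tight.  The last conclusion says that [v] is a vertex. *)
Lemma vertex_above x a : bounded Hpoly -> Hpoly x ->
  exists v, [/\ Hpoly v, tight x \subset tight v, linform a x <= linform a v &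
    forall d, (forall i, i \in tight v -> linform (A i) d = 0) -> d = 0].
Proof.
move=> [M PM] Px.
pose V := [set v | [/\ Hpoly v, tight x \subset tight v & linform a x <= linform a v]].
have [||v [[Pv xv av] vmax]] := @exists_argmax _ V (fun v => #|tight v|) #|L|.
- by move=> v _; exact: max_card.
- by exists x; split.
exists v; split=> // d; apply: contraPP => /eqP d0 dker.
(* Replace [d] by its opposite if needed so that [a] does not decrease. *)
wlog ad : d d0 dker / 0 <= linform a d.
  move=> H; have [|ad] := leP 0 (linform a d); first exact: H.
  apply: (H (- d)); first by rewrite oppr_eq0.
    by move=> i /dker; rewrite linformN => ->; rewrite oppr0.
  by rewrite linformN oppr_ge0 ltW.
pose up i := (i \in S) && (0 < linform (A i) d).
have [i0 up0|noup] := pickP up; last first.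
  have Pray s : 0 <= s -> Hpoly (v + s *: d).
    move=> s0 i iS; rewrite !linformE; have := noup i; rewrite /up iS /= => /negbT.
    rewrite -leNgt => di; rewrite (le_trans _ (Pv i iS))// gerDl.
    exact: mulr_ge0_le0.
  have /rV0Pn[j dj] := d0; have dj' : 0 < `|d 0 j| by rewrite normr_gt0.
  have M0 : 0 <= M by exact: le_trans (PM _ Pv j).
  pose s := (M + `|v 0 j| + 1) / `|d 0 j|.
  have s0 : 0 <= s by rewrite divr_ge0// !addr_ge0.
  have := PM _ (Pray s s0) j; rewrite !mxE.
  have : `|s * d 0 j| = M + `|v 0 j| + 1.
    by rewrite normrM (ger0_norm s0) /s divfK// gt_eqF.
  have := ler_normB (v 0 j + s * d 0 j) (v 0 j).
  by rewrite addrAC subrr add0r; lra.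
(* The first inequality to become tight along the ray is that of least ratio. *)
pose ratio i := (b i - linform (A i) v) / linform (A i) d.
have [i /andP[iS di] imin] := @arg_minP _ _ _ i0 up ratio up0.
have s0 : 0 <= ratio i.
  by rewrite /ratio divr_ge0 ?(ltW di)// subr_ge0 Pv.
set s := ratio i in s0 imin.
have Pw : Hpoly (v + s *: d).
  move=> j jS; rewrite !linformE; have [dj|dj] := ltP 0 (linform (A j) d).
    have : s <= ratio j by apply: imin; rewrite /up jS.
    by rewrite /ratio ler_pdivlMr// lerBrDl.
  by rewrite (le_trans _ (Pv j jS))// gerDl mulr_ge0_le0.
have vw : tight v \subset tight (v + s *: d).
  apply/fintype.subsetP => j jv; have /tightP[jS jb] := jv.
  by apply/tightP; split=> //; rewrite !linformE dker// mulr0 addr0.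
have : (#|tight (v + s *: d)| <= #|tight v|)%N.
  apply: vmax; split=> //; first exact: fintype.subset_trans vw.
  by rewrite !linformE (le_trans av)// lerDl mulr_ge0.
apply/negP; rewrite -ltnNge; apply/proper_card/properP; split=> //.
exists i.
  apply/tightP; split=> //.
  by rewrite !linformE /s /ratio divfK ?gt_eqF// addrC subrK.
by apply/negP => /dker/eqP; rewrite gt_eqF.
Qed.

End Presentation.

Section Onto.

Variable A : L -> 'cV[R]_n.

(** Linear independence of the normals with labels in [J], in dual form: a
    vector can be chosen with arbitrary values of these linear forms.  This is
    the form in which it is used to move inside a face, and it makes sense
    without enumerating [J]. *)
Definition independent J := forall t : L -> R, exists d, forall i, i \in J -> linform (A i) d = t i.

Lemma independent_sub J J' : J \subset J' -> independent J' -> independent J.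
Proof. by move=> /fintype.subsetP JJ' o t; have [d dt] := o t; exists d => i /JJ'; exact: dt. Qed.

Definition normals_mx J : 'M[R]_(n, #|J|) := \matrix_(k, j) A (enum_val j) k 0.

Lemma mul_normals J x j : (x *m normals_mx J) 0 j = linform (A (enum_val j)) x.
Proof. by rewrite /linform !mxE; apply: eq_bigr => k _; rewrite mxE. Qed.

Lemma ker_normalsP J d :
  (d <= kermx (normals_mx J))%MS <-> forall i, i \in J -> linform (A i) d = 0.
Proof.
split=> [/sub_kermxP h i iJ|h].
  by rewrite -(enum_rankK_in iJ iJ) -mul_normals h mxE.
apply/sub_kermxP/matrixP => i j; rewrite ord1 mul_normals mxE h//.
exact: enum_valP.
Qed.

Lemma independent_rank J : independent J -> \rank (normals_mx J) = #|J|.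
Proof.
move=> o; apply/eqP; apply/row_fullP.
have /choice[B BP] : forall j : 'I_#|J|, exists d : 'rV[R]_n,
    forall i, i \in J -> linform (A i) d = (i == enum_val j)%:R.
  by move=> j; have [d dP] := o (fun i => (i == enum_val j)%:R); exists d.
exists (\matrix_j B j); apply/row_matrixP => j; rewrite row_mul rowK.
apply/matrixP => k l; rewrite ord1 mul_normals BP ?enum_valP// !mxE.
by rewrite (inj_eq enum_val_inj) eq_sym.
Qed.

Lemma rank_independent J : \rank (normals_mx J) = #|J| -> independent J.
Proof.
move=> /eqP/row_fullP[B BP] t.
exists ((\row_j t (enum_val j)) *m B) => i iJ.
by rewrite -(enum_rankK_in iJ iJ) -mul_normals -mulmxA BP mulmx1 mxE.
Qed.

End Onto.

End Halfspaces.

(** * Simple presentations *)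

Section SimplePresentation.

Variables (R : realType) (n : nat) (L : finType).
Variables (S : {set L}) (A : L -> 'cV[R]_n) (b : L -> R).
Implicit Types (x y d : 'rV[R]_n) (J : {set L}) (F : set 'rV[R]_n).

Local Notation P := (Hpoly S A b).
Local Notation HF := (Hface S A b).
Local Notation tight := (tight S A b).

(** Genericity at every point amounts to simplicity: no point lies on more
    facets than the codimension of its smallest face. *)
Definition generic := forall x, P x -> independent A (tight x).

Lemma tight_sub x : tight x \subset S.
Proof. by apply/fintype.subsetP => i /tightP[]. Qed.

Lemma Hface_has_dim x : generic -> P x -> has_dim (HF (tight x)) (n - #|tight x|).
Proof.
move=> gen Px; set J := tight x.
have xt y : HF J y -> forall i, i \in J -> linform (A i) y = b i by case.
have HFx : HF J x by apply/HfaceE => //; exact: tight_sub.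
rewrite -(independent_rank (gen _ Px)) -mxrank_ker; apply: (has_dimP HFx).
  move=> y z /xt yt /xt zt; apply/ker_normalsP => i iJ.
  by rewrite !linformE yt ?zt ?subrr.
move=> d /ker_normalsP dker.
have [i /dker->//|e e0 eP] := @Hpoly_move _ _ _ S A b x d Px.
exists e; first by rewrite gt_eqF.
split=> [|i iJ]; first by apply: eP; rewrite lexx ltW.
by rewrite !linformE dker// mulr0 addr0 xt.
Qed.

Hypothesis gen : generic.

(** By independence, a point of [HF J] can be pushed off all the facets that are
    tight there but not listed in [J]; so distinct nonempty sets [HF J] have
    distinct sets of tight inequalities. *)
Lemma Hface_exact J x : J \subset S -> HF J x ->
  exists2 y, HF J y & tight y = J.
Proof.
move=> JS /(HfaceE _ _ _ JS)[Px Jx].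
have [d dP] := gen Px (fun i => if i \in J then 0 else -1).
have [i /dP->|e e0 eP] := @Hpoly_move _ _ _ S A b x d Px.
  by case: ifP => // _; rewrite oppr_le0.
have Pe : P (x + e *: d) by apply: eP; rewrite lexx ltW.
(* Half of the admissible step keeps the other inequalities slack. *)
pose y := x + (e / 2) *: d.
have Py : P y by apply: eP; apply/andP; split; lra.
have ty : tight y = J.
  apply/setP => i; apply/tightP/idP => [[iS]|iJ]; last first.
    have ix := fintype.subsetP Jx i iJ; have /tightP[iS xi] := ix.
    by rewrite !linformE dP// iJ mulr0 addr0.
  have [ix|ix] := boolP (i \in tight x).
    have /tightP[_ xi] := ix.
    rewrite !linformE dP// xi; case: ifP => // _; lra.
  by have := slack Px iS ix; have := Pe _ iS; rewrite !linformE; lra.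
by exists y => //; apply/HfaceE => //; rewrite ty.
Qed.

Lemma Hface_sub J J' : J \subset S -> J' \subset S -> HF J !=set0 ->
  HF J `<=` HF J' <-> J' \subset J.
Proof.
move=> JS J'S [x Jx]; have [y Jy tJ] := Hface_exact JS Jx.
split; first by move=> /(_ _ Jy)/(HfaceE _ _ _ J'S)[_]; rewrite tJ.
move=> J'y z [Pz zy].
by split=> // i /(fintype.subsetP J'y); exact: zy.
Qed.

Lemma Hface_inj J J' : J \subset S -> J' \subset S -> HF J !=set0 ->
  HF J = HF J' -> J = J'.
Proof.
move=> JS J'S J0 E; have J'0 : HF J' !=set0 by rewrite -E.
apply/eqP; rewrite finset.eqEsubset.
by apply/andP; split; apply/Hface_sub; rewrite ?E.
Qed.

Lemma codim_faceP k F : P !=set0 -> codim_face P k F <->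
  exists J, [/\ J \subset S, HF J !=set0, #|J| = k & F = HF J].
Proof.
move=> [x0 Px0].
have dimJ J x : J \subset S -> HF J x -> has_dim (HF J) (n - #|J|) /\ (#|J| <= n)%N.
  move=> JS Jx; have [y [Py _] <-] := Hface_exact JS Jx.
  by split; [exact: Hface_has_dim|rewrite -(independent_rank (gen Py)) rank_leq_row].
have P0 : HF finset.set0 = P by apply/seteqP; split=> [x []//|x Px]; split=> // i; rewrite inE.
have dimP : has_dim P n.
  by have := @dimJ finset.set0 x0 (finset.sub0set _); rewrite P0 cards0 subn0 => /(_ Px0)[].
split.
  move=> [fF [d [dP dF]]]; have [[x Fx] _] := dF.
  have [|y [J [Fy tJ FE]]] := faceP fF; first by exists x.
  have JS : J \subset S by rewrite -tJ tight_sub.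
  exists J; rewrite FE in Fy *; split=> //; first by exists y.
  have [dJ Jn] := dimJ _ _ JS Fy; rewrite FE in dF.
  by have := has_dim_uniq dP dimP; have := has_dim_uniq dF dJ; lia.
move=> [J [JS [x Jx] <- ->]]; split; first exact: face_Hface.
have [dJ Jn] := dimJ _ _ JS Jx.
by exists (n - #|J|)%N; rewrite subnK.
Qed.

Lemma facetP F : P !=set0 -> facet P F <->
  exists2 i, i \in S & HF [set i]%SET !=set0 /\ F = HF [set i]%SET.
Proof.
move=> P0; rewrite /facet codim_faceP//; split.
  move=> [J [JS J0 /eqP/cards1P[i JE] ->]]; subst J.
  by exists i => //; rewrite -finset.sub1set.
by move=> [i iS [i0 ->]]; exists [set i]%SET; rewrite cards1 finset.sub1set.
Qed.

(** The face [{v}] has dimension [0], and also [n] minus the number of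
    independent inequalities tight at [v]. *)
Lemma vertexP v : vertex P v -> P v /\ #|tight v| = n.
Proof.
move=> fv; have [|x [J [vx tJ vE]]] := faceP fv; first by exists v.
have xv : x = v by []. subst x.
have Pv : P v.
  have : [set v] v by []. by rewrite vE => -[].
split=> //; have := Hface_has_dim gen Pv; rewrite tJ -vE => dn.
have dv : has_dim [set v] 0.
  have := @has_dimP R n [set v] 0 v erefl; rewrite mxrank0; apply.
    by move=> y z -> ->; rewrite subrr sub0mx.
  by move=> d; rewrite submx0 => /eqP->; exists 1; rewrite ?oner_eq0// scaler0 addr0.
have := has_dim_uniq dn dv; rewrite -tJ.
by have := rank_leq_row (normals_mx A (tight v)); rewrite (independent_rank (gen Pv)); lia.
Qed.

End SimplePresentation.

(** * Flag polytopes as clique complexes *)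

Lemma card_finset_image (L : finType) (T : Type) (f : L -> T) (J : {set L}) :
  {in J &, injective f} -> f @` [set` J] #= `I_#|J|.
Proof.
move=> fJ; rewrite (card_eqr card_II) card_eq_sym.
have -> : f @` [set` J] = (f \o (@enum_val _ (mem J))) @` [set: 'I_#|J|].
  apply/seteqP; split=> t [i /= iJ <-].
    by exists (enum_rank_in iJ i) => //=; rewrite enum_rankK_in.
  by exists (enum_val i) => //=; exact: enum_valP.
rewrite card_eq_sym; apply: inj_card_eq => i j _ _ /= /fJ E.
by apply: enum_val_inj; apply: E; exact: enum_valP.
Qed.

Section Realization.

Variables (R : realType) (n : nat) (L : finType).
Implicit Types (x y d : 'rV[R]_n) (S J : {set L}) (F : set 'rV[R]_n).
Implicit Types (A : L -> 'cV[R]_n) (b : L -> R) (adj : rel L).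

Definition clique adj J := {in J &, forall i j, i != j -> adj i j}.

(** [P] is a bounded polyhedron, simple by genericity, whose facets are labelled
    by [S] and whose nerve is the clique complex of [adj].  Restricting the labels
    to a subset [S] of a fixed type lets facets be added one at a time without
    changing that type. *)
Definition realizes S adj A b (P : set 'rV[R]_n) :=
  [/\ P = Hpoly S A b, bounded P, generic S A b &
    forall J, J \subset S -> Hface S A b J !=set0 <-> clique adj J].

Section Consequences.

Variables (S : {set L}) (adj : rel L) (A : L -> 'cV[R]_n) (b : L -> R).
Variable P : set 'rV[R]_n.
Hypothesis rP : realizes S adj A b P.

Local Notation HF := (Hface S A b).

Lemma realizes_neq0 : P !=set0.
Proof.
have [PE _ _ nerve] := rP.
have /nerve[_ [|x [Px _]]] := finset.sub0set S; last by exists x; rewrite PE.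
by move=> i j; rewrite inE.
Qed.

Lemma realizes_facet_neq0 i : i \in S -> HF [set i]%SET !=set0.
Proof.
have [_ _ _ nerve] := rP => iS; apply/nerve; first by rewrite finset.sub1set.
by move=> j k /set1P-> /set1P->; rewrite eqxx.
Qed.

Lemma realizes_facetP F : facet P F <-> exists2 i, i \in S & F = HF [set i]%SET.
Proof.
have [PE _ gen _] := rP; have P0 := realizes_neq0; rewrite PE in P0 *.
rewrite facetP//; split=> [[i iS [_ ->]]|[i iS ->]]; exists i => //.
by split=> //; exact: realizes_facet_neq0.
Qed.

Lemma realizes_facet_inj : {in S &, injective (fun i => HF [set i]%SET)}.
Proof.
have [PE _ gen _] := rP => i j iS jS /(Hface_inj gen).
rewrite !finset.sub1set => /(_ iS jS (realizes_facet_neq0 iS)).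
exact: finset.set1_inj.
Qed.

Lemma realizes_polytope : polytope P.
Proof.
have [PE bd _ _] := rP; split; last exact: bd.
rewrite PE.
exists #|S|, (fun i => A (enum_val i)), (fun i => b (enum_val i)).
apply/seteqP; split=> x Px i; first by apply: Px; exact: enum_valP.
by move=> iS; rewrite -(enum_rankK_in iS iS); exact: Px.
Qed.

Lemma realizes_simple : simple_polytope P n.
Proof.
have [PE bd gen nerve] := rP; have P0 := realizes_neq0.
split; first exact: realizes_polytope.
  have : codim_face P 0 (HF finset.set0).
    rewrite PE in P0 *; apply/codim_faceP => //.
    exists finset.set0; rewrite cards0 finset.sub0set; split=> //.
    apply/nerve; first exact: finset.sub0set.
    by move=> i j; rewrite inE.
  move=> [_ [d [dP dF]]]; rewrite addn0 in dP.
  have [x Px] := P0; rewrite PE in Px.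
  have H0 : HF finset.set0 x by split=> // i; rewrite inE.
  have [y [Py _] ty] := Hface_exact gen (finset.sub0set _) H0.
  have := Hface_has_dim gen Py; rewrite ty cards0 subn0 => dn.
  by have E := has_dim_uniq dn dF; rewrite -E in dP.
move=> v; rewrite PE => /(vertexP gen)[Pv vn].
have -> : [set F | facet (Hpoly S A b) F /\ F v] =
    (fun i => HF [set i]%SET) @` [set` tight S A b v].
  rewrite -PE; apply/seteqP; split=> F.
    move=> [/realizes_facetP[i iS ->] [_ vi]]; exists i => //=; apply/tightP.
    by split=> //; apply: vi; rewrite inE.
  move=> [i /= /tightP[iS vi] <-]; split; first by apply/realizes_facetP; exists i.
  by split=> // j /set1P->.
suff : (fun i => HF [set i]%SET) @` [set` tight S A b v] #= `I_#|tight S A b v|.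
  by rewrite vn.
apply: card_finset_image => i j /tightP[iS _] /tightP[jS _].
exact: realizes_facet_inj.
Qed.

Lemma realizes_adj i j : i \in S -> j \in S -> i != j ->
  (forall k l, adj k l = adj l k) ->
  HF [set i]%SET `&` HF [set j]%SET !=set0 <-> adj i j.
Proof.
move=> iS jS ij sym; have [PE _ gen nerve] := rP.
have -> : HF [set i]%SET `&` HF [set j]%SET = HF [set i; j]%SET.
  apply/seteqP; split=> x.
    move=> [[Px xi] [_ xj]]; split=> // k /set2P[] ->; [apply: xi|apply: xj];
    by rewrite inE.
  by move=> [Px xij]; split; split=> // k /set1P ->; apply: xij; rewrite !inE eqxx ?orbT.
rewrite nerve; last by rewrite finset.subUset !finset.sub1set iS.
split; first by apply; rewrite ?inE ?eqxx ?orbT.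
by move=> aij k l /set2P[]-> /set2P[]->; rewrite ?eqxx// sym.
Qed.

(** A family of pairwise intersecting facets is a clique, so the nerve condition
    gives a common point. *)
Lemma realizes_flag : (forall k l, adj k l = adj l k) -> flag_polytope P n.
Proof.
move=> sym; split; first exact: realizes_simple.
have [PE _ gen nerve] := rP => Fs Fsub Fmeet.
pose J : {set L} := [set i in S | `[< Fs (HF [set i]%SET) >]]%SET.
have JS : J \subset S by apply/fintype.subsetP => i; rewrite inE => /andP[].
have /nerve[_ [|x [Px xJ]]] := JS.
  move=> i j; rewrite !inE => /andP[iS /asboolP Fi] /andP[jS /asboolP Fj] ij.
  by apply/(realizes_adj iS jS ij sym); exact: Fmeet.
exists x => F FF; have /realizes_facetP[i iS FE] := Fsub _ FF.
rewrite FE; split=> // j /set1P->; apply: xJ; rewrite inE iS; apply/asboolP.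
by rewrite -FE.
Qed.

End Consequences.

Lemma face0 P : face P (@set0 'rV[R]_n).
Proof.
exists 0, 1; split=> [x _|]; first by rewrite linform0l.
apply/seteqP; split=> x // [_ /=]; rewrite linform0l => /eqP.
by rewrite eq_sym oner_eq0.
Qed.

Lemma realizes_face S adj A b P F : realizes S adj A b P ->
  face P F <-> F = set0 \/ exists J, [/\ J \subset S, clique adj J & F = Hface S A b J].
Proof.
move=> [PE _ gen nerve]; split; last first.
  move=> [->|[J [JS _ ->]]]; first exact: face0.
  by rewrite PE; exact: face_Hface.
rewrite PE => fF; have [->|F0] := eqVneq F set0; [by left|right].
have [|x [J [Fx tJ FE]]] := faceP fF; first exact/set0P.
have JS : J \subset S by rewrite -tJ; exact: tight_sub.
exists J; split=> //; apply/nerve => //; exists x; by rewrite -FE.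
Qed.

End Realization.

(** A face is sent to the face with the same clique, which is read off as the set
    of facets containing the face; the empty face is contained in all facets
    and is treated apart. *)
Lemma realizes_comb_equiv (R : realType) (n m : nat) (L : finType) (S : {set L})
  (adj : rel L) A b A' b' (P : set 'rV[R]_n) (Q : set 'rV[R]_m) :
  realizes S adj A b P -> realizes S adj A' b' Q -> comb_equiv P Q.
Proof.
move=> rP rQ; have [_ _ genP nP] := rP; have [_ _ genQ nQ] := rQ.
pose f F : set 'rV[R]_m := [set y | F !=set0 /\
  Hface S A' b' [set i in S | `[< F `<=` Hface S A b [set i]%SET >]]%SET y].
have f0 : f set0 = set0 by apply/seteqP; split=> y // [[]].
have fJ (J : {set L}) : J \subset S -> clique adj J -> f (Hface S A b J) = Hface S A' b' J.
  move=> JS cJ; have J0 : Hface S A b J !=set0 by apply/nP.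
  rewrite /f; have -> : [set i in S | `[< Hface S A b J `<=` Hface S A b [set i]%SET >]]%SET = J.
    apply/setP => i; rewrite inE; apply/andP/idP => [[iS /asboolP]|iJ].
      by move/(Hface_sub genP JS); rewrite !finset.sub1set; apply.
    have iS := fintype.subsetP JS _ iJ; split=> //; apply/asboolP/(Hface_sub genP JS) => //;
    by rewrite finset.sub1set.
  by apply/seteqP; split=> y // [].
exists f; split; first split.
- move=> F /(realizes_face _ rP) [->|[J [JS cJ ->]]]; apply/(realizes_face _ rQ).
    by left.
  by right; exists J; rewrite fJ.
- move=> F G; rewrite !inE => /(realizes_face _ rP) [->|[J [JS cJ ->]]]
    /(realizes_face _ rP) [->|[K [KS cK ->]]] //; rewrite ?f0 !fJ//.
  + by have /nQ[_ /(_ cK)[y yK]] := KS => E; move: yK; rewrite -E.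
  + by have /nQ[_ /(_ cJ)[y yJ]] := JS => E; move: yJ; rewrite E.
  + by move/(Hface_inj genQ JS KS) => -> //; apply/nQ.
- move=> G /(realizes_face _ rQ) [->|[J [JS cJ ->]]].
    by exists set0 => //; exact: face0.
  by exists (Hface S A b J); [apply/(realizes_face _ rP); right; exists J|exact: fJ].
move=> F G /(realizes_face _ rP) [->|[J [JS cJ ->]]];
  first by rewrite f0; split=> _; exact: sub0set.
have [x xJ] : Hface S A b J !=set0 by apply/nP.
have [y yJ] : Hface S A' b' J !=set0 by apply/nQ.
move=> /(realizes_face _ rP) [->|[K [KS cK ->]]].
  by rewrite f0 fJ//; split=> [/(_ _ xJ)|/(_ _ yJ)].
rewrite !fJ// (Hface_sub genP)//; last by exists x.
by rewrite (Hface_sub genQ)//; exists y.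
Qed.

(** * Shaving a face of codimension two *)

(** The clique complex of [adj'] is the subdivision of the edge [uv] in the clique
    complex of [adj], with [w] as the new vertex; dually, this is what shaving
    does to the boundary of a simple polytope. *)
Section EdgeSubdivision.

Variables (L : finType) (S : {set L}) (adj adj' : rel L) (u v w : L).
Implicit Types J : {set L}.

Hypotheses (adj_sym : symmetric adj) (adj'_sym : symmetric adj').
Hypotheses (uS : u \in S) (vS : v \in S) (wS : w \notin S).
Hypothesis uv : u != v.
Hypothesis adj_uv : adj u v.
Hypothesis adj'_old : {in S &, forall x y, x != y ->
  adj' x y = adj x y && ([set x; y]%SET != [set u; v]%SET)}.
Hypothesis adj'_new : {in S, forall x, adj' x w = [|| x == u, x == v | adj x u && adj x v]}.

Local Notation D := [set u; v]%SET.

Lemma sub_edge J : (D \subset J) = (u \in J) && (v \in J).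
Proof. by rewrite finset.subUset !finset.sub1set. Qed.

Lemma clique_old J : J \subset S ->
  clique adj' J <-> clique adj J /\ ~~ (D \subset J).
Proof.
move=> /fintype.subsetP JS; split=> [c|[c nD] x y xJ yJ xy].
  split=> [x y xJ yJ xy|].
    by have := c _ _ xJ yJ xy; rewrite adj'_old ?JS// => /andP[].
  rewrite sub_edge; apply/negP => /andP[uJ vJ].
  by have := c _ _ uJ vJ uv; rewrite adj'_old// eqxx andbF.
rewrite adj'_old ?JS// c//=; apply: contraNneq nD => <-.
by rewrite finset.subUset !finset.sub1set xJ.
Qed.

Lemma clique_new J : J \subset S ->
  clique adj' (w |: J)%SET <-> clique adj (J :|: D)%SET /\ ~~ (D \subset J).
Proof.
move=> JS; have /fintype.subsetP JS' := JS; have xw x : x \in S -> x != w.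
  by apply: contraTneq => ->.
split=> [c|[c nD] x y].
  have [c1 nD] : clique adj J /\ ~~ (D \subset J).
    by apply/clique_old => // x y xJ yJ; apply: c; rewrite inE ?xJ ?yJ orbT.
  split=> // x y.
  have N z : z \in J -> [|| z == u, z == v | adj z u && adj z v].
    by move=> zJ; rewrite -adj'_new ?JS'//; apply: c; rewrite ?inE ?zJ ?eqxx ?orbT// xw ?JS'.
  have E z : z \in J -> forall t, t \in D -> z != t -> adj z t.
    move=> zJ t tD zt; case/or3P: (N z zJ) tD zt => [/eqP->|/eqP->|/andP[zu zv]].
    - by rewrite !inE => /orP[]/eqP->; rewrite ?eqxx.
    - by rewrite !inE => /orP[]/eqP->; rewrite ?eqxx// adj_sym.
    - by rewrite !inE => /orP[]/eqP->.
  move=> /finset.setUP[xJ|xD] /finset.setUP[yJ|yD] xy; first exact: c1.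
  - exact: E.
  - by rewrite adj_sym E// eq_sym.
  - move: xD yD xy; rewrite !inE => /orP[]/eqP-> /orP[]/eqP->; rewrite ?eqxx//.
    by rewrite adj_sym.
have cJ : clique adj' J.
  apply/clique_old => //; split=> // z t zJ tJ; apply: c; rewrite inE ?zJ ?tJ//.
have N z : z \in J -> adj' z w.
  move=> zJ; rewrite adj'_new ?JS'//.
  have [//|zu] := eqVneq z u; have [//|zv] := eqVneq z v.
  by rewrite !c// !inE ?zJ ?eqxx ?orbT.
move=> /finset.setU1P[->|xJ] /finset.setU1P[->|yJ]; rewrite ?eqxx// => xy.
- by rewrite adj'_sym N.
- exact: N.
- exact: cJ.
Qed.

End EdgeSubdivision.

Section Shaving.

Variables (R : realType) (n : nat) (L : finType).
Implicit Types (x y d : 'rV[R]_n) (J : {set L}).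

Variables (S : {set L}) (adj adj' : rel L) (u v w : L).
Hypotheses (adj_sym : symmetric adj) (adj'_sym : symmetric adj').
Hypotheses (uS : u \in S) (vS : v \in S) (wS : w \notin S).
Hypothesis uv : u != v.
Hypothesis adj_uv : adj u v.
Hypothesis adj'_old : {in S &, forall i j, i != j ->
  adj' i j = adj i j && ([set i; j]%SET != [set u; v]%SET)}.
Hypothesis adj'_new : {in S, forall i, adj' i w = [|| i == u, i == v | adj i u && adj i v]}.

Variables (A : L -> 'cV[R]_n) (b : L -> R) (P : set 'rV[R]_n).
Hypothesis rP : realizes S adj A b P.

Local Notation D := [set u; v]%SET.
Local Notation HF := (Hface S A b).
Local Notation a := (A u + A v).

(** The sum of the slacks of the two facets; it is positive on the polytope
    except on the face to be shaved off. *)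
Definition depth x := b u + b v - linform a x.

Lemma depth_le0 x : Hpoly S A b x -> (depth x <= 0) = (D \subset tight S A b x).
Proof.
move=> Px; have xu := Px _ uS; have xv := Px _ vS.
rewrite /depth linform_addl sub_edge !inE uS vS /=.
apply/idP/andP => [h|[/eqP-> /eqP->]]; last by rewrite subrr.
by split; apply/eqP; lra.
Qed.

(** A cutting depth [e] so small that no face outside the shaved one disappears.
    Applied to single points, it says that every other vertex lies deeper than
    [e]. *)
Lemma depth_witness : exists2 e, 0 < e & forall J, J \subset S -> HF J !=set0 ->
  ~~ (D \subset J) -> exists2 x, HF J x & e < depth x.
Proof.
have [_ _ gen _] := rP.
pose Q (J : {set L}) s := J \subset S -> HF J !=set0 ->
  ~~ (D \subset J) -> exists2 x, HF J x & s < depth x.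
suff [e e0 eQ] : exists2 e, 0 < e & forall J s, 0 <= s <= e -> Q J s.
  by exists e => // J; apply: eQ; rewrite lexx ltW.
apply: exists_small => J.
have [[JS [[x xJ] nD]]|h] := pselect (J \subset S /\ HF J !=set0 /\ ~~ (D \subset J)); last first.
  by exists 1 => // s _ JS J0 nD; case: h.
have [y yJ ty] := Hface_exact gen JS xJ; have [Py _] := yJ.
have d0 : 0 < depth y by rewrite ltNge depth_le0// ty.
exists (depth y / 2); first lra.
by move=> s /andP[_ sd] _ _ _; exists y => //; lra.
Qed.

Variable e : R.
Hypothesis e0 : 0 < e.
Hypothesis eP : forall J, J \subset S -> HF J !=set0 ->
  ~~ (D \subset J) -> exists2 x, HF J x & e < depth x.

Definition normal' i := if i == w then a else A i.
Definition level' i := if i == w then b u + b v - e else b i.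

Local Notation A' := normal'.
Local Notation b' := level'.
Local Notation S' := (w |: S)%SET.
Local Notation Q := (Hpoly S' A' b').

Lemma old_label i : i \in S -> (i == w) = false.
Proof. by move=> iS; apply: contraNF wS => /eqP<-. Qed.

Lemma shavedP x : Q x <-> Hpoly S A b x /\ e <= depth x.
Proof.
rewrite /depth; split=> [Qx|[Px ex] i].
  split=> [i iS|].
    by have := Qx i; rewrite inE iS orbT /A' /b' old_label//; apply.
  by have := Qx w; rewrite !inE eqxx /A' /b' eqxx /= => /(_ erefl); lra.
rewrite !inE /A' /b'; have [_ _|_ /=] := eqVneq i w; first lra.
exact: Px.
Qed.

Lemma tight_shaved x i : i \in S -> (i \in tight S' A' b' x) = (i \in tight S A b x).
Proof. by move=> iS; rewrite !inE iS orbT /A' /b' old_label. Qed.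

Lemma tight_shaved_new x : (w \in tight S' A' b' x) = (depth x == e).
Proof.
rewrite !inE /A' /b' eqxx /= /depth.
by apply/eqP/eqP => h; [rewrite h|rewrite -h]; ring.
Qed.

Lemma vertex_depth p : Hpoly S A b p -> (forall x, HF (tight S A b p) x -> x = p) ->
  ~~ (D \subset tight S A b p) -> e < depth p.
Proof.
move=> Pp pu nD; have [||x /pu->//] := eP _ _ nD; first exact: tight_sub.
by exists p; apply/HfaceE => //; exact: tight_sub.
Qed.

(** A face meeting the cut has a vertex not deeper than the cut, which must then
    lie on the shaved face. *)
Lemma vertex_below x : Hpoly S A b x -> depth x <= e ->
  exists p, [/\ Hpoly S A b p, tight S A b x \subset tight S A b p & D \subset tight S A b p].
Proof.
have [PE bd _ _] := rP; rewrite PE in bd => Px xe.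
have [p [Pp xp ap ker]] := vertex_above a bd Px.
exists p; split=> //; apply: contraT => /vertex_depth h.
suff : e < depth p by rewrite /depth in xe *; lra.
apply: h => // y [Py yt]; apply/eqP; rewrite -subr_eq0; apply/eqP/ker => i it.
by have /tightP[_ pi] := it; rewrite !linformE yt// pi subrr.
Qed.

(** On the cut, the new linear form is not constant on the smallest face
    containing [x]: it differs between [x] and a vertex of that face lying on the
    shaved face. *)
Lemma shaved_generic : generic S' A' b'.
Proof.
have [PE bd gen _] := rP => x Qx; have [Px xe] := (shavedP x).1 Qx.
have old i : i \in tight S' A' b' x -> i != w -> i \in tight S A b x.
  move=> it iw; rewrite -tight_shaved//.
  by have /tightP[] := it; rewrite finset.in_setU1 (negPf iw).
have [xe'|xe'] := eqVneq (depth x) e; last first.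
  move=> t; have [d dt] := gen _ Px t; exists d => i it.
  have iw : i != w by apply: contraNneq xe' => iw; rewrite iw tight_shaved_new in it.
  by rewrite /A' (negPf iw) dt// old.
have [|p [Pp xp Dp]] := vertex_below Px; first by rewrite xe'.
move=> t; have [d dt] := gen _ Px t.
have ap : linform a (p - x) = e.
  move: xe'; rewrite -depth_le0// in Dp.
  have : 0 <= depth p by rewrite /depth linform_addl; have := Pp _ uS; have := Pp _ vS; lra.
  by move: Dp; rewrite /depth !linformE; lra.
exists (d + ((t w - linform a d) / e) *: (p - x)) => i it; rewrite /A'.
have [->|iw] := eqVneq i w.
  by rewrite linformD linformZ ap divfK ?gt_eqF// addrC subrK.
have ix := old _ it iw; have /tightP[_ xi] := ix.
have /tightP[_ pi] := fintype.subsetP xp _ ix.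
by rewrite !linformE pi xi subrr mulr0 addr0 dt.
Qed.

(** A face survives when it is not contained in the shaved one, and meets the
    cut when moreover it meets the shaved one: it then contains points on both
    sides of the cut. *)
Lemma shaved_nerve J : J \subset S' -> Hface S' A' b' J !=set0 <-> clique adj' J.
Proof.
have [PE bd gen nerve] := rP.
have HFE (K : {set L}) x : K \subset S -> Hface S' A' b' K x <-> HF K x /\ e <= depth x.
  move=> KS; have KS' : K \subset S' by apply: fintype.subset_trans KS (finset.subsetUr _ _).
  have E : (K \subset tight S' A' b' x) = (K \subset tight S A b x).
    by apply/fintype.subsetP/fintype.subsetP => h i iK;
      have := h i iK; rewrite tight_shaved ?(fintype.subsetP KS).
  by rewrite HfaceE// E HfaceE// shavedP; tauto.
move=> JS; have [wJ|wJ] := boolP (w \in J); last first.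
  have JS0 : J \subset S.
    apply/fintype.subsetP => i iJ; have := fintype.subsetP JS i iJ.
    by rewrite finset.in_setU1 => /orP[/eqP iw|//]; rewrite -iw iJ in wJ.
  rewrite (clique_old uS vS uv adj'_old JS0); split.
    move=> [x /(HFE _ _ JS0)[xJ xe]]; split; first by apply/nerve => //; exists x.
    apply/negP => DJ; have [Px Jx] := (HfaceE _ _ _ JS0).1 xJ.
    have := fintype.subset_trans DJ Jx; rewrite -depth_le0// leNgt.
    by rewrite (lt_le_trans e0).
  move=> [cJ nD]; have [|x xJ xe] := eP JS0 _ nD; first exact/nerve.
  by exists x; apply/HFE => //; split=> //; exact: ltW.
pose K := (J :\ w)%SET; have JE : J = (w |: K)%SET by rewrite finset.setD1K.
have KS : K \subset S.
  apply/fintype.subsetP => i; rewrite !inE => /andP[iw] /(fintype.subsetP JS).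
  by rewrite finset.in_setU1 (negPf iw).
rewrite [clique _ _](_ : _ = clique adj' (w |: K)%SET) -?JE//.
have DS : D \subset S by rewrite sub_edge uS.
have KDS : (K :|: D)%SET \subset S by rewrite finset.subUset KS.
rewrite {2}JE (clique_new adj_sym adj'_sym uS vS wS uv adj_uv adj'_old adj'_new KS) -nerve//.
have HJE x : Hface S' A' b' J x <-> HF K x /\ depth x = e.
  rewrite HfaceE// {1}JE finset.subUset finset.sub1set tight_shaved_new HfaceE//.
  have -> : (K \subset tight S' A' b' x) = (K \subset tight S A b x).
    by apply/fintype.subsetP/fintype.subsetP => h i iK;
      have := h i iK; rewrite tight_shaved ?(fintype.subsetP KS).
  rewrite shavedP; split=> [[[Px _] /andP[/eqP xe Kx]]|[[Px Kx] xe]]; first by split.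
  by rewrite xe lexx eqxx.
split=> [[x /HJE[xK xe]]|[[y yKD] nD]].
  have [Px Kx] := (HfaceE _ _ _ KS).1 xK; split.
    have [|p [Pp xp Dp]] := vertex_below Px; first by rewrite xe.
    exists p; apply/HfaceE => //; split=> //.
    by rewrite finset.subUset Dp (fintype.subset_trans Kx xp).
  apply/negP => DK; have := fintype.subset_trans DK Kx.
  by rewrite -depth_le0// xe leNgt e0.
have [Py] := (HfaceE _ _ _ KDS).1 yKD; rewrite finset.subUset => /andP[Ky Dy].
have yK : HF K y by apply/HfaceE.
have [|x xK xe] := eP KS _ nD; first by exists y.
have [Px _] := xK.
have s01 : 0 <= e / depth x <= 1.
  have dx : 0 < depth x by exact: lt_trans xe.
  apply/andP; split; first by rewrite divr_ge0 ?ltW.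
  by rewrite ler_pdivrMr// mul1r ltW.
exists (y + (e / depth x) *: (x - y)); apply/HJE; split.
  split; first exact: Hpoly_conv.
  by move=> i iK; rewrite !linformE (xK.2 _ iK) (yK.2 _ iK) subrr mulr0 addr0.
have yu : linform (A u) y = b u by apply: yKD.2; rewrite !inE eqxx orbT.
have yv : linform (A v) y = b v by apply: yKD.2; rewrite !inE eqxx !orbT.
have dx : depth x != 0 by rewrite gt_eqF// (lt_trans e0).
move: dx; rewrite /depth !linformE yu yv => dx; field.
by rewrite -?opprD ?addrA in dx *.
Qed.

Lemma shaved_realizes : realizes S' adj' A' b' Q.
Proof.
have [PE [M PM] _ _] := rP; split=> //; last exact: shaved_nerve.
- by exists M => x /shavedP[Px _]; apply: PM; rewrite PE.
- exact: shaved_generic.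
Qed.

Lemma shaved_shaving : shaving P (HF D) Q.
Proof.
have [PE _ gen nerve] := rP; have DS : D \subset S by rewrite sub_edge uS.
have vx p : vertex P p -> Hpoly S A b p /\ forall x, HF (tight S A b p) x -> x = p.
  rewrite PE => fp; have [|q [J [qp tJ vE]]] := faceP fp; first by exists p.
  have E : q = p by []. subst q.
  have Pp : Hpoly S A b p by have : [set p] p by []; rewrite vE => -[].
  by split=> // x; rewrite tJ -vE.
exists a, (b u + b v - e); split.
- have /nerve[_ [|x xD]] := DS.
    move=> i j; rewrite !inE => /orP[]/eqP-> /orP[]/eqP->; rewrite ?eqxx//.
    by rewrite adj_sym.
  have [Px Dx] := (HfaceE _ _ _ DS).1 xD.
  have [d dt] := gen _ Px (fun=> 1).
  move: Dx; rewrite sub_edge => /andP[/dt du /dt dv].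
  apply/eqP => a0; have : linform a d = 0 by rewrite a0 linform0l.
  by rewrite linform_addl du dv; lra.
- move=> p /vx[Pp pu]; apply/eqP => pe.
  have dpe : depth p = e by rewrite /depth pe; ring.
  have [|nD] := boolP (D \subset tight S A b p); first by rewrite -depth_le0// dpe leNgt e0.
  by have := vertex_depth Pp pu nD; rewrite dpe ltxx.
- move=> p /vx[Pp pu]; rewrite HfaceE//; split=> [h|[_]].
    split=> //; apply: contraT => /(vertex_depth Pp pu).
    by rewrite /depth; lra.
  by rewrite -depth_le0// /depth; have := e0; lra.
- rewrite PE; apply/seteqP; split=> x.
    by move=> /shavedP[Px xe]; split=> //=; move: xe; rewrite /depth; lra.
  by move=> [Px /= xe]; apply/shavedP; split=> //; rewrite /depth; lra.
Qed.

Lemma shaved_codim : codim_face P 2 (HF D).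
Proof.
have [PE _ gen nerve] := rP; have DS : D \subset S by rewrite sub_edge uS.
have P0 := realizes_neq0 rP; rewrite PE in P0 *; apply/codim_faceP => //.
exists D; split=> //; last by rewrite cards2 uv.
apply/nerve => // i j; rewrite !inE => /orP[]/eqP-> /orP[]/eqP->; rewrite ?eqxx//.
by rewrite adj_sym.
Qed.

End Shaving.

Lemma realizes_shaving (R : realType) (n : nat) (L : finType)
    (S : {set L}) (adj adj' : rel L) (u v w : L)
    (A : L -> 'cV[R]_n) (b : L -> R) (P : set 'rV[R]_n) :
  symmetric adj -> symmetric adj' ->
  u \in S -> v \in S -> w \notin S -> u != v -> adj u v ->
  {in S &, forall x y, x != y ->
    adj' x y = adj x y && ([set x; y]%SET != [set u; v]%SET)} ->
  {in S, forall i, adj' i w = [|| i == u, i == v | adj i u && adj i v]} ->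
  realizes S adj A b P ->
  exists G Q, [/\ codim_face P 2 G, shaving P G Q &
    exists A' b', realizes (w |: S)%SET adj' A' b' Q].
Proof.
move=> sym sym' uS vS wS uv auv old new rP.
have [e e0 eP] := depth_witness uS vS rP.
exists (Hface S A b [set u; v]%SET), (Hpoly (w |: S)%SET (normal' u v w A) (level' u v w b e)).
split; first exact: shaved_codim rP.
  exact: shaved_shaving e0 eP.
exists (normal' u v w A), (level' u v w b e).
exact: (shaved_realizes sym sym' uS vS wS uv auv old new rP e0 eP).
Qed.

(** * Presentations of flag polytopes *)

(** Discard redundant inequalities from the given presentation; each remaining
    one is then tight, alone, at some point [z], so it defines a facet.  If [y]
    violated it but satisfied the chosen inequality of that facet, then the point
    [u] where the segment from an interior point [x0] to [y] crosses the
    hyperplane of the facet would satisfy the chosen inequality strictly, while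
    the chosen form is constant on that hyperplane. *)
Lemma facets_define (R : realType) (n : nat) (I : finType) (S : {set I})
    (A : I -> 'cV[R]_n) (b : I -> R) (y : 'rV[R]_n) :
  (0 < n)%N -> has_dim (Hpoly S A b) n ->
  (forall F, facet (Hpoly S A b) F -> exists a c,
    [/\ forall x, Hpoly S A b x -> linform a x <= c,
        F = Hpoly S A b `&` [set x | linform a x = c] & linform a y <= c]) ->
  Hpoly S A b y.
Proof.
move=> n0; have := @exists_argmin _ [set T : {set I} | Hpoly T A b = Hpoly S A b]
  (fun T : {set I} => #|T|).
case=> [|T [/= <- Tmin]]; first by exists S.
move=> dimP facets; have [[p Pp] [U [rU UP Umin]]] := dimP.
have irr i : i \in T -> exists z, [/\ forall j, j \in T -> j != i ->
    linform (A j) z <= b j & b i < linform (A i) z].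
  move=> iT; apply/not_existsP => none.
  suff E : Hpoly (T :\ i)%SET A b = Hpoly T A b.
    have := Tmin (T :\ i)%SET E; rewrite [X in (X <= _)%N](cardsD1 i) iT; lia.
  apply/seteqP; split=> z Pz j; last by move=> /finset.setD1P[_]; exact: Pz.
  move=> jT; rewrite leNgt; apply/negP => zj.
  have [ji|ji] := eqVneq j i; last first.
    by have := Pz j; rewrite !inE ji jT leNgt zj => /(_ isT).
  subst j; apply: (none z); split=> // j jT' ji.
  by apply: Pz; rewrite !inE ji.
have [//|||x0 Px0 x0min] := @exists_relint _ _ _ T A b (Hpoly T A b); first by exists p.
  by move=> *; exact: Hpoly_conv.
have Ane0 i : i \in T -> A i != 0.
  move=> iT; apply/eqP => Ai0; have [z [_]] := irr _ iT.
  by have := Pp _ iT; rewrite Ai0 !linform0l; lra.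
have int i : i \in T -> linform (A i) x0 < b i.
  move=> iT; apply: (slack Px0 iT); apply/negP => ix.
  have /mxrankS : (U <= kermx (A i))%MS.
    apply: Umin => x x' Px Px'; apply/ker1P.
    have /tightP[_ xi] := fintype.subsetP (x0min _ Px) _ ix.
    have /tightP[_ xi'] := fintype.subsetP (x0min _ Px') _ ix.
    by rewrite linformB xi xi' subrr.
  by rewrite rU rank_ker1 ?Ane0//; lia.
have cut i x : i \in T -> b i < linform (A i) x -> exists2 s, 0 < s < 1 &
    linform (A i) (x0 + s *: (x - x0)) = b i.
  move=> iT xi; have x0i := int _ iT.
  have d0 : 0 < linform (A i) x - linform (A i) x0 by lra.
  exists ((b i - linform (A i) x0) / (linform (A i) x - linform (A i) x0)).
    apply/andP; split; first by rewrite divr_gt0 // subr_gt0.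
    by rewrite ltr_pdivrMr// mul1r; lra.
  by rewrite !linformE divfK ?gt_eqF//; ring.
move=> i iT; rewrite leNgt; apply/negP => yi.
have [w [wj wi]] := irr _ iT.
have [s /andP[s0 s1] zi] := cut _ _ iT wi; set z := x0 + _ in zi.
have [s' /andP[s'0 s'1] ui] := cut _ _ iT yi; set u := x0 + _ in ui.
have zj j : j \in T -> j != i -> linform (A j) z < b j.
  move=> jT ji; rewrite /z !linformE; have := wj _ jT ji; have := int _ jT; nra.
have uE a : linform a u = linform a x0 + s' * (linform a y - linform a x0).
  by rewrite /u !linformE.
clearbody z u.
have Pz : Hpoly T A b z.
  by move=> j jT; have [->|/zj/ltW->//] := eqVneq j i; rewrite zi.
have iTs : [set i]%SET \subset T by rewrite finset.sub1set.
have tz : tight T A b z \subset [set i]%SET.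
  apply/fintype.subsetP => j /tightP[jT zjE]; rewrite inE; apply: contraT => ji.
  by have := zj _ jT ji; rewrite zjE ltxx.
have near d : linform (A i) d = 0 -> exists2 e, 0 < e & Hface T A b [set i]%SET (z + e *: d).
  move=> di; have [j /(fintype.subsetP tz)/set1P->|e e0 eP] := @Hpoly_move _ _ _ T A b z d Pz.
    by rewrite di.
  exists e => //; split; first by apply: eP; rewrite lexx ltW.
  by move=> j /set1P->; rewrite !linformE zi di mulr0 addr0.
have Fz : Hface T A b [set i]%SET z by split=> // j /set1P->.
have dF : has_dim (Hface T A b [set i]%SET) n.-1.
  rewrite -(rank_ker1 (Ane0 _ iT)); apply: (has_dimP Fz).
    move=> x x' [_ xi] [_ xi']; apply/ker1P.
    by rewrite linformB xi ?xi' ?subrr// inE.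
  by move=> d /ker1P/near[e e0 Fe]; exists e; rewrite ?gt_eqF.
have fF : facet (Hpoly T A b) (Hface T A b [set i]%SET).
  split; first exact: face_Hface.
  by exists n.-1; rewrite addn1 prednK.
have [a [c [Pac FE yc]]] := facets _ fF.
have onF x : Hface T A b [set i]%SET x -> linform a x = c by rewrite FE => -[].
have x0c : linform a x0 < c.
  rewrite lt_neqAle Pac// andbT; apply/eqP => x0c.
  have : Hface T A b [set i]%SET x0 by rewrite FE.
  by move=> [_ /(_ i)]; rewrite inE eqxx => /(_ isT) E; have := int _ iT; rewrite E ltxx.
have [|e e0 Fe] := near (u - z); first by rewrite linformB ui zi subrr.
have := onF _ Fe; rewrite !linformE (onF _ Fz).
have : linform a u < c by rewrite uE; nra.
by nra.
Qed.

(** Simplicity is a condition at the vertices only, but the inequalities tight at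
    a point are tight at some vertex.  At a vertex the [n] normals of the facets
    through it leave no direction free, hence they are independent. *)
Lemma flag_realizes (R : realType) (n : nat) (L : finType) (adj : rel L)
    (P : set 'rV[R]_n) (phi : L -> set 'rV[R]_n) :
  (0 < n)%N -> flag_polytope P n -> set_bij [set: L] (facet P) phi ->
  (forall i j, i != j -> phi i `&` phi j !=set0 <-> adj i j) ->
  exists A b, realizes [set: L]%SET adj A b P.
Proof.
move=> n0 [[polP dimP simP] flagP] [phiF phiI phiS] phiadj.
have fphi i : facet P (phi i) by exact: phiF.
have [[k [A0 [b0 PE0]]] bdP] := polP.
have PE1 : P = Hpoly [set: 'I_k]%SET A0 b0.
  by rewrite PE0; apply/seteqP; split=> x Px i //; exact: Px.
have /choice[ab abP] : forall i, exists ac : 'cV[R]_n * R,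
    (forall x, P x -> linform ac.1 x <= ac.2) /\ phi i = P `&` [set x | linform ac.1 x = ac.2].
  by move=> i; have [[a [c H]] _] := fphi i; exists (a, c).
pose A i := (ab i).1; pose b i := (ab i).2.
have PE : P = Hpoly [set: L]%SET A b.
  apply/seteqP; split=> y; first by move=> Py i _; exact: (abP i).1.
  move=> yab; rewrite PE1; apply: facets_define => //; first by rewrite -PE1.
  move=> F; rewrite -PE1 => /phiS[i _ <-].
  by exists (A i), (b i); split; [exact: (abP i).1|exact: (abP i).2|exact: yab].
have phiE i x : phi i x <-> P x /\ linform (A i) x = b i by rewrite (abP i).2.
have phi0 i : phi i !=set0 by have [_ [d [_ [F0 _]]]] := fphi i.
exists A, b; split=> //.
  move=> x Px; have bdH : bounded (Hpoly [set: L]%SET A b) by rewrite -PE.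
  have [p [Pp xp _ ker]] := vertex_above 0 bdH Px.
  apply: (independent_sub xp); apply: rank_independent; set J := tight _ _ _ p.
  have pF : [set p] = Hface [set: L]%SET A b J.
    apply/seteqP; split=> [_ ->|y [Py yJ]].
      by apply/HfaceE => //; apply/fintype.subsetP => i; rewrite inE.
    apply/eqP; rewrite -subr_eq0; apply/eqP/ker => i it.
    by have /tightP[_ pi] := it; rewrite linformB yJ// pi subrr.
  have vp : vertex P p.
    rewrite /vertex pF PE; apply: face_Hface.
    by apply/fintype.subsetP => i; rewrite inE.
  have := simP _ vp.
  have -> : [set F | facet P F /\ F p] = phi @` [set` J].
    apply/seteqP; split=> F.
      move=> [/phiS[i _ <-] /phiE[_ pi]]; exists i => //=; apply/tightP.
      by rewrite inE.
    move=> [i /= /tightP[_ pi] <-]; split=> //; apply/phiE; split=> //.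
    by rewrite PE.
  have cJ : phi @` [set` J] #= `I_#|J|.
    by apply: card_finset_image => i j _ _ /phiI; apply; rewrite inE.
  rewrite (card_eql cJ) => /card_eq_II Jn.
  have ker0 : kermx (normals_mx A J) = 0.
    apply/row_matrixP => i; rewrite row0; apply: ker => j jJ.
    by have /ker_normalsP := row_sub i (kermx (normals_mx A J)); apply.
  have := mxrank_ker (normals_mx A J); rewrite ker0 mxrank0.
  move: Jn (rank_leq_row (normals_mx A J)); move: (\rank _) => r; lia.
move=> J _; split=> [[x [Px xJ]] i j iJ jJ ij|cJ].
  by apply/phiadj => //; exists x; split; apply/phiE; rewrite PE; split=> //; exact: xJ.
have [J0|[i0 iJ]] := set_0Vmem J.
  have [x Px] := dimP.1; exists x; rewrite J0; split; first by rewrite -PE.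
  by move=> i; rewrite inE.
have [||x xJ] := flagP (phi @` [set` J]).
- by move=> _ [i _ <-].
- move=> _ _ [i /= iJ' <-] [j /= jJ <-].
  have [->|ij] := eqVneq i j; first by rewrite setIid.
  by apply/phiadj => //; exact: cJ.
have onJ i : i \in J -> P x /\ linform (A i) x = b i.
  by move=> iJ'; have /xJ/phiE : (phi @` [set` J]) (phi i) by exists i.
exists x; split; first by rewrite -PE; case: (onJ _ iJ).
by move=> i /onJ[].
Qed.

(** * Adding the arcs by increasing length *)

Section Model.

Variable n : nat.
Hypothesis n2 : (2 <= n)%N.

(** The pair [(i, k)] stands for the arc of length [k.+2] leaving [i], drawn on a
    circle with [n] marked points. *)
Definition cyc_arc : Type := ('I_n * 'I_(n - 2))%type.
Definition label : Type := (cyc_arc + 'I_n * bool)%type.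

(** For [a < b] and [c < d], this is the condition for the chords [ab] and [cd] of
    a convex polygon to cross in their interiors. *)
Definition interleave (a b c d : nat) : bool :=
  [|| [&& a < c, c < b & b < d] | [&& c < a, a < d & d < b]]%N.

(** Arcs are lifted to intervals of the real line, which has to be done up to
    translation by [n]; as starting points lie below [n] and lengths are smaller
    than [n], translating by [n] in either direction is enough. *)
Definition arcs_cross (i l j m : nat) : bool :=
  [|| interleave i (i + l) j (j + m), interleave (i + n) (i + n + l) j (j + m)
    | interleave i (i + l) (j + n) (j + n + m)].

Definition arc_over (i l j : nat) : bool :=
  ((i < j < i + l) || (i < j + n < i + l))%N.

(** An interval with an endpoint of another one in its interior overlaps it
    partially, unless it contains it and is longer. *)
Lemma interleave_short a b m l : (m <= l)%N -> (m < l)%N || (a != b) ->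
  interleave a (a + m) b (b + l) = (a < b < a + m)%N || (a < b + l < a + m)%N.
Proof. by rewrite /interleave; lia. Qed.

(** Apply [interleave_short] to the three pairs of lifts: the endpoints of the
    longer arc, the second of which is [e] modulo [n], are then tested in all
    their positions relative to the shorter one. *)
Lemma arcs_cross_short i j l m e : (i < n)%N -> (j < n)%N -> (l < n)%N ->
  (m <= l)%N -> (m < l)%N || (j != i) ->
  e = (if i + l < n then i + l else i + l - n)%N ->
  arcs_cross j m i l = arc_over j m i || arc_over j m e.
Proof.
move=> lin ljn lln ml ne ->; rewrite /arcs_cross /arc_over.
rewrite !interleave_short//; try lia.
have -> : (j + n < i < j + n + m)%N = false by lia.
case: ifP => h.
  have -> : (j + n < i + l < j + n + m)%N = false by lia.
  have -> : (i + l + n = i + n + l)%N by lia.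
  move: (j < i < j + m)%N (j < i + l < j + m)%N (j < i + n < j + m)%N.
  by move: (j < i + n + l < j + m)%N => [] [] [] [].
have -> : (j < i + n + l < j + m)%N = false by lia.
have -> : (j + n < i + l < j + n + m)%N = (j < i + l - n < j + m)%N by lia.
have -> : (i + l - n + n = i + l)%N by lia.
move: (j < i < j + m)%N (j < i + l < j + m)%N (j < i + n < j + m)%N.
by move: (j < i + l - n < j + m)%N => [] [] [] [].
Qed.

(** The distance from [i] to [j] along the oriented circle. *)
Definition gap (i j : nat) : nat := (if i <= j then j - i else j + n - i)%N.

(** Adjacency of [(i,+)] and [(j,-)] when the arcs in [T] have been created: the
    distance [1] corresponds to opposite facets of the cube, and the other pairs
    are separated by the arc from [i] to [j]. *)
Definition joined (T : {set cyc_arc}) (i j : 'I_n) : bool :=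
  (gap i j != 1%N) && ~~ [exists k, ((i, k) \in T) && (k.+2 == gap i j)].

Definition label_adj (T : {set cyc_arc}) : rel label := fun x y =>
  match x, y with
  | inl (i, k), inl (j, m) => ~~ arcs_cross i k.+2 j m.+2
  | inl (i, k), inr (j, _) => ~~ arc_over i k.+2 j
  | inr (j, _), inl (i, k) => ~~ arc_over i k.+2 j
  | inr (i, true), inr (j, false) => joined T i j
  | inr (i, false), inr (j, true) => joined T j i
  | inr _, inr _ => true
  end.

Lemma label_adj_sym T : symmetric (label_adj T).
Proof.
move=> [[i k]|[i []]] [[j m]|[j []]] //=; congr (~~ _).
by rewrite /arcs_cross /interleave; lia.
Qed.

Definition present (T : {set cyc_arc}) : {set label} :=
  [set x | if x is inl a then a \in T else true]%SET.

Lemma n_gt0 : (0 < n)%N. Proof. exact: leq_trans n2. Qed.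

Section Cube.

Variable R : realType.

Definition cube_normal (x : label) : 'cV[R]_n :=
  match x with
  | inl _ => 0
  | inr (i, true) => delta_mx i 0
  | inr (i, false) => - delta_mx (ord_pred i) 0
  end.

Definition cube_level (x : label) : R := if x is inr (_, true) then 1 else 0.

Lemma linform_delta i (x : 'rV[R]_n) : linform (delta_mx i 0) x = x 0 i.
Proof.
rewrite /linform mxE (bigD1 i)//= big1 => [|j ji]; last by rewrite mxE (negPf ji) mulr0.
by rewrite mxE !eqxx mulr1 addr0.
Qed.

Lemma linform_deltaN i (x : 'rV[R]_n) : linform (- delta_mx i 0) x = - x 0 i.
Proof. by rewrite /linform mulmxN mxE -/(linform _ _) linform_delta. Qed.

Lemma gap_pred (i j : 'I_n) : (gap i j == 1%N) = (i == ord_pred j).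
Proof.
have := ltn_ord i; have := ltn_ord j; rewrite -(inj_eq val_inj) /= /gap => jn i_n.
have [j0|j0] := posnP j.
  rewrite j0 add0n modn_small; last by rewrite prednK// n_gt0.
  by case: ifP; lia.
have -> : ((j + n).-1 %% n)%N = j.-1.
  by rewrite -[(j + n).-1]subn1 -addnBAC// subn1 modnDr modn_small//; lia.
by case: ifP; lia.
Qed.

(** With [x_i <= 1] for [(i,+)] and [0 <= x_i] for [(i + 1,-)], disjoint facets of
    the cube are the pairs of diameters at distance [1]. *)
Lemma cube_realizes :
  realizes (present finset.set0) (label_adj finset.set0) cube_normal cube_level
    (@std_cube R n).
Proof.
have inrS i c : inr (i, c) \in present finset.set0 by rewrite inE.
have PE : @std_cube R n = Hpoly (present finset.set0) cube_normal cube_level.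
  apply/seteqP; split=> x Px.
    move=> [a|[i []]]; rewrite !inE// => _.
      by rewrite linform_delta; have /andP[] := Px i.
    by rewrite linform_deltaN oppr_le0; have /andP[] := Px (ord_pred i).
  move=> i; apply/andP; split.
    have := Px _ (inrS (ordS i) false); rewrite linform_deltaN oppr_le0.
    by rewrite ordSK.
  by have := Px _ (inrS i true); rewrite linform_delta.
split=> //.
- exists 1 => x Px j; have /andP[] := Px j => x0 x1.
  by rewrite ger0_norm.
- move=> x Px t.
  exists (\row_i if x 0 i == 1 then t (inr (i, true)) else - t (inr (ordS i, false))).
  move=> [a|[i []]] /tightP[]; first by rewrite !inE.
    by move=> _; rewrite !linform_delta mxE => ->; rewrite eqxx.
  move=> _; rewrite !linform_deltaN mxE => /eqP; rewrite oppr_eq0 => /eqP->.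
  by rewrite eq_sym oner_eq0 opprK ord_predK.
move=> J /fintype.subsetP JS; have Jarc a : inl a \in J -> False by move=> /JS; rewrite !inE.
split=> [[x [Px xJ]]|cJ].
  have nj i j : inr (i, true) \in J -> inr (j, false) \in J -> joined finset.set0 i j.
    move=> /xJ; rewrite linform_delta => xi /xJ; rewrite linform_deltaN => xj.
    apply/andP; split; last by apply/existsPn => k; rewrite inE.
    apply/negP; rewrite gap_pred => /eqP ij; move: xj; rewrite -ij xi => /eqP.
    by rewrite oppr_eq0 oner_eq0.
  move=> [a|[i c]] [a'|[j c']] iJ jJ; try by [case: (Jarc _ iJ)|case: (Jarc _ jJ)].
  by case: c c' iJ jJ => [] [] //= iJ jJ _; exact: nj.
exists (\row_i (inr (i, true) \in J)%:R); split=> [|y yJ].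
  by rewrite -PE => i; rewrite mxE; case: (inr (i, true) \in J); rewrite ?lexx ?ler01.
case: y yJ => [a /Jarc//|[i []]] iJ; first by rewrite linform_delta mxE iJ.
rewrite linform_deltaN mxE.
have [jJ|_] := boolP (inr (ord_pred i, true) \in J); last by rewrite oppr0.
have ne : (inr (ord_pred i, true) : label) != inr (i, false).
  by apply/eqP => -[_].
have := cJ _ _ jJ iJ ne; rewrite /= /joined.
by have -> : gap (ord_pred i) i == 1%N by rewrite gap_pred.
Qed.

End Cube.

Lemma inr_eqE (a a' : 'I_n * bool) : ((inr a : label) == inr a') = (a == a').
Proof. by apply/eqP/eqP => [[]|->]. Qed.

(** When arcs are created by increasing length, [(i0, k0)], which ends at [j0],
    can come next after those in [T]. *)
Section Step.

Variables (T : {set cyc_arc}) (i0 : 'I_n) (k0 : 'I_(n - 2)) (j0 : 'I_n).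
Hypothesis T_le : forall i k, (i, k) \in T -> (k <= k0)%N.
Hypothesis T_ge : forall i (k : 'I_(n - 2)), (k < k0)%N -> (i, k) \in T.
Hypothesis w_notin : (i0, k0) \notin T.
Hypothesis gap0 : gap i0 j0 = k0.+2.

Local Notation u := (inr (i0, true) : label).
Local Notation v := (inr (j0, false) : label).
Local Notation w := (inl (i0, k0) : label).
Local Notation T' := ((i0, k0) |: T)%SET.

Lemma gap_inj : (forall i : 'I_n, gap i j0 = k0.+2 -> i = i0) *
  (forall j : 'I_n, gap i0 j = k0.+2 -> j = j0).
Proof.
have := ltn_ord i0; have := ltn_ord j0; move: gap0; rewrite /gap => h hj hi.
split=> i hg; apply/val_inj => /=; have := ltn_ord i; move: h hg;
  by do 2 case: ifP; lia.
Qed.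

(** Pairs at distance [1] are opposite in the cube.  Among the arcs that leave [i0]
    or arrive at [j0], the present ones are those shorter than the new arc, so
    the pairs at distances from [2] to [k0.+1] are separated too. *)
Lemma joined_top i j : (i == i0) || (j == j0) ->
  joined T i j = (gap i j == 0%N) || (k0.+2 <= gap i j)%N.
Proof.
move=> ij; have gn : (gap i j < n)%N.
  by have := ltn_ord i; have := ltn_ord j; rewrite /gap; case: ifP; lia.
apply/andP/idP => [[g1]|].
  apply: contraR; rewrite negb_or -ltnNge => /andP[g0 gk].
  have kP : (gap i j - 2 < n - 2)%N by lia.
  apply/existsP; exists (Ordinal kP); rewrite T_ge /=; last by lia.
  by apply/eqP; lia.
move=> h; split; first by lia.
apply/existsPn => k; apply/negP => /andP[kT /eqP kg].
have kk0 := T_le kT; have k0E : k = k0 by apply/val_inj => /=; lia.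
subst k; move: kT; case/orP: ij => /eqP E; subst.
  by rewrite (negPf w_notin).
by rewrite (gap_inj.1 i) ?(negPf w_notin).
Qed.

Lemma joined_step i j :
  joined T' i j = joined T i j && ~~ ((i == i0) && (j == j0)).
Proof.
rewrite /joined -andbA; congr (_ && _).
apply/idP/andP => [/existsPn h|[/existsPn h ij]].
  split.
    apply/existsPn => k; have := h k.
    by apply: contra => /andP[kT ->]; rewrite inE kT orbT.
  apply/negP => /andP[/eqP E /eqP E']; subst.
  by have := h k0; rewrite !inE eqxx gap0 eqxx.
apply/existsPn => k; apply/negP => /andP[]; rewrite inE => /orP[|kT kg]; last first.
  by have := h k; rewrite kT kg.
rewrite inE => /eqP[E1 E2]; subst => /eqP kg.
by move: ij; rewrite eqxx (gap_inj.2 j) ?eqxx.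
Qed.

Lemma label_step_old : {in present T &, forall x y, x != y ->
  label_adj T' x y = label_adj T x y && ([set x; y]%SET != [set u; v]%SET)}.
Proof.
move=> x y _ _ xy.
have -> : ([set x; y]%SET == [set u; v]%SET) = ((x == u) && (y == v)) || ((x == v) && (y == u)).
  apply/eqP/idP => [E|/orP[]/andP[/eqP-> /eqP->]//]; last by rewrite finset.setUC.
  have xin : x \in [set u; v]%SET by rewrite -E !inE eqxx.
  have uin : u \in [set x; y]%SET by rewrite E !inE eqxx.
  have vin : v \in [set x; y]%SET by rewrite E !inE eqxx orbT.
  case/set2P: xin => xE.
    by case/set2P: vin => vE; [rewrite xE in vE|rewrite xE -vE !eqxx].
  by case/set2P: uin => uE; [rewrite xE in uE|rewrite xE -uE !eqxx orbT].
case: x y {xy} => [[i k]|[i []]] [[j m]|[j []]] //=;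
  rewrite ?inr_eqE ?xpair_eqE ?andbF ?andbT ?orbF//.
- exact: joined_step.
- by rewrite joined_step; congr (_ && ~~ _); exact: andbC.
Qed.

(** For the arcs this is [arcs_cross_short], as those already present are not
    longer than the new one; for the diameters both sides say that the endpoint
    is not strictly under the new arc. *)
Lemma label_step_new : {in present T, forall x,
  label_adj T' x w = [|| x == u, x == v | label_adj T x u && label_adj T x v]}.
Proof.
have := ltn_ord i0; have := ltn_ord j0; have := ltn_ord k0; move: gap0 => g0 lk lj li.
move=> [[j m]|[j []]]; rewrite inE /= => jT.
- have := ltn_ord j; have := T_le jT; have := ltn_ord m => lm mk ljj.
  rewrite (@arcs_cross_short _ _ _ _ j0) ?negb_or//; try lia.
    (* The new arc itself is not among them. *)
    rewrite -implyNb; apply/implyP; rewrite -leqNgt => km; apply: contraNneq w_notin => ji.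
    by rewrite -(val_inj ji : j = i0) -(_ : m = k0)//; apply/val_inj => /=; lia.
  by move: g0; rewrite /gap; case: ifP; case: ifP; lia.
- rewrite !inr_eqE !xpair_eqE !andbF !andbT joined_top ?eqxx ?orbT// -(inj_eq val_inj) /=.
  have := ltn_ord j; move: g0; rewrite /gap /arc_over.
  by do 2 case: ifP; lia.
- rewrite !inr_eqE !xpair_eqE !andbF !andbT joined_top ?eqxx// -(inj_eq val_inj) /=.
  have := ltn_ord j; move: g0; rewrite /gap /arc_over.
  by do 2 case: ifP; lia.
Qed.

Lemma present_step : present T' = (w |: present T)%SET.
Proof. by apply/setP => -[a|a]; rewrite !inE//= orbT. Qed.

End Step.

Lemma shaved_label_adj (R : realType) (T : {set cyc_arc}) :
  (forall i j (k m : 'I_(n - 2)), (i, k) \in T -> (m < k)%N -> (j, m) \in T) ->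
  exists Q : set 'rV[R]_n, cube_shaved Q /\
    exists A b, realizes (present T) (label_adj T) A b Q.
Proof.
have [s] := ubnP #|T|; elim: s T => // s IH T Ts closed.
have [->|[a0 a0T]] := set_0Vmem T.
  exists (@std_cube R n); split; first exact: cube_shaved_cube.
  by exists (cube_normal R), (cube_level R); exact: cube_realizes.
have [[i0 k0] /= w_in kmax] := @arg_maxnP _ a0 (mem T) (fun a => a.2 : nat) a0T.
pose T0 := (T :\ (i0, k0))%SET.
have TE : ((i0, k0) |: T0)%SET = T by exact: finset.setD1K.
have T0T a : a \in T0 -> a \in T by rewrite inE => /andP[].
have le i k : (i, k) \in T0 -> (k <= k0)%N by move=> /T0T/kmax.
have ge i (k : 'I_(n - 2)) : (k < k0)%N -> (i, k) \in T0.
  move=> kk; rewrite !inE xpair_eqE (closed _ _ _ _ w_in kk) andbT negb_and.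
  by apply/orP; right; apply: contraTneq kk => ->; rewrite ltnn.
have w_notin : (i0, k0) \notin T0 by rewrite !inE eqxx.
have [||Q [shQ [A [b rQ]]]] := IH T0.
- by rewrite -TE cardsU1 w_notin in Ts.
- move=> i j k m /le kk mk; apply: ge; exact: leq_trans kk.
have [j0 gap0] : exists j0 : 'I_n, gap i0 j0 = k0.+2.
  have := ltn_ord i0; have := ltn_ord k0 => lk li.
  have [h|h] := ltnP (i0 + k0.+2) n.
    by exists (Ordinal h); rewrite /gap /=; case: ifP; lia.
  have h' : (i0 + k0.+2 - n < n)%N by lia.
  by exists (Ordinal h'); rewrite /gap /=; case: ifP; lia.
have uv : joined T0 i0 j0.
  by rewrite (joined_top le ge w_notin gap0) ?eqxx// gap0 leqnn orbT.
have [||||G [Q' [codim sh rQ']]] := realizes_shaving (u := inr (i0, true))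
  (v := inr (j0, false)) (w := inl (i0, k0)) (@label_adj_sym T0)
  (@label_adj_sym ((i0, k0) |: T0)%SET) _ _ _ _ uv (label_step_old w_notin gap0)
  (label_step_new le ge w_notin gap0) rQ; rewrite ?inE ?eqxx ?inr_eqE ?xpair_eqE ?andbF//.
exists Q'; rewrite -TE present_step; split=> //.
exact: cube_shaved_step shQ codim sh.
Qed.

End Model.

(** * Crossing diagonals of a regular polygon *)

Section Orientation.

Variable R : realType.
Implicit Types x y z w : 'rV[R]_2.

(** Twice the signed area of the triangle [x y z]. *)
Definition orient x y z : R :=
  (y 0 0 - x 0 0) * (z 0 1 - x 0 1) - (y 0 1 - x 0 1) * (z 0 0 - x 0 0).

Lemma orient_affine x y z w t :
  orient x y ((1 - t) *: z + t *: w) = (1 - t) * orient x y z + t * orient x y w.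
Proof. by rewrite /orient !mxE; ring. Qed.

Lemma orientxyx x y : orient x y x = 0. Proof. by rewrite /orient; ring. Qed.
Lemma orientxyy x y : orient x y y = 0. Proof. by rewrite /orient; ring. Qed.

Lemma orient_swap x y z : orient x z y = - orient x y z.
Proof. by rewrite /orient; ring. Qed.

Lemma orient_rot x y z : orient y z x = orient x y z.
Proof. by rewrite /orient; ring. Qed.

(** The parameters of the crossing point are ratios of areas: along [xy], the
    signed area of the triangle on the base [zw] is affine and changes sign, and
    likewise along [zw] for the base [xy]. *)
Lemma segments_meet x y z w : 0 < orient x z y -> 0 < orient x y w ->
  0 < orient z w x -> 0 < orient z y w ->
  exists t t', [/\ 0 < t < 1, 0 < t' < 1 &
    (1 - t) *: x + t *: y = (1 - t') *: z + t' *: w].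
Proof.
rewrite orient_swap (orient_swap z w) !oppr_gt0 => xyz xyw zwx zwy.
pose t := orient z w x / (orient z w x - orient z w y).
pose t' := - orient x y z / (orient x y w - orient x y z).
have d0 : 0 < orient z w x - orient z w y by lra.
have d0' : 0 < orient x y w - orient x y z by lra.
exists t, t'; split.
- by rewrite /t divr_gt0//= ltr_pdivrMr// mul1r; lra.
- by rewrite /t' divr_gt0//= ?oppr_gt0// ltr_pdivrMr// mul1r; lra.
have e : orient x y w - orient x y z = orient z w x - orient z w y.
  by rewrite /orient; ring.
rewrite /t /t' e; move: d0; rewrite lt0r => /andP[d0 _].
apply/rowP => i; rewrite !mxE.
have [->|->] : i = 0 \/ i = 1 by case: i => [[|[|//]]] ?; [left|right]; exact/val_inj.
  by move: d0; rewrite /orient => d0; field.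
by move: d0; rewrite /orient => d0; field.
Qed.

End Orientation.

Section Polygon.

Variables (R : realType) (n : nat).
Hypothesis n0 : (0 < n)%N.
Implicit Types p q r s : 'I_n.*2.

Local Notation V := (@polygon_vertex R n).
Local Notation chord := (@diagonal_interior R n).

(** The area of a triangle inscribed in the unit circle; the half angles are used
    as variables so that, with [cos ^+ 2 + sin ^+ 2 = 1], it becomes a
    polynomial identity. *)
Lemma orient_circle (a b c : R) :
  let pt t : 'rV[R]_2 := \row_(k < 2) (if k == 0 then cos (t + t) else sin (t + t)) in
  orient (pt a) (pt b) (pt c) = 4 * sin (b - a) * sin (c - b) * sin (c - a).
Proof.
rewrite /= /orient !mxE /= !sinB !cosD !sinD.
have := cos2Dsin2 a; have := cos2Dsin2 b; have := cos2Dsin2 c.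
set ca := cos a; set sa := sin a; set cb := cos b; set sb := sin b.
set cc := cos c; set sc := sin c => hc hb ha.
pose x0 := ca * ca - sa * sa; pose x1 := sa * ca + ca * sa.
pose y0 := cb * cb - sb * sb; pose y1 := sb * cb + cb * sb.
pose z0 := cc * cc - sc * sc; pose z1 := sc * cc + cc * sc.
(* Make the left-hand side homogeneous in each pair [(cos, sin)]. *)
transitivity ((y0 * z1 - y1 * z0) * (ca ^+ 2 + sa ^+ 2) +
  (z0 * x1 - z1 * x0) * (cb ^+ 2 + sb ^+ 2) +
  (x0 * y1 - x1 * y0) * (cc ^+ 2 + sc ^+ 2)).
  by rewrite ha hb hc /x0 /x1 /y0 /y1 /z0 /z1; ring.
by rewrite /x0 /x1 /y0 /y1 /z0 /z1; ring.
Qed.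

Lemma orient_gt0 p q r : (p < q < r)%N -> 0 < orient (V p) (V q) (V r).
Proof.
move=> /andP[pq qr]; pose h (i : 'I_n.*2) : R := pi * i%:R / (n%:R * 2).
have n20 : 0 < n%:R * 2 :> R by rewrite mulr_gt0// ltr0n.
have nn0 : (n%:R : R) != 0 by rewrite pnatr_eq0 -lt0n.
have VE i : V i = \row_(k < 2) (if k == 0 then cos (h i + h i) else sin (h i + h i)).
  have -> : h i + h i = pi * i%:R / n%:R by rewrite /h; field.
  by apply/rowP => k; rewrite !mxE.
rewrite !VE orient_circle.
have sgt (i j : 'I_n.*2) : (i < j)%N -> 0 < sin (h j - h i).
  move=> ij; apply: sin_gt0_pi.
  have -> : h j - h i = pi * ((j - i)%N%:R / (n%:R * 2)).
    by rewrite natrB ?(ltnW ij)// /h; field.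
  have pi0 := pi_gt0 R.
  have f0 : 0 < (j - i)%N%:R / (n%:R * 2) :> R by rewrite divr_gt0// ltr0n subn_gt0.
  rewrite mulr_gt0//= gtr_pMr// ltr_pdivrMr// mul1r -natrM ltr_nat.
  by have := ltn_ord j; lia.
by rewrite !mulr_gt0// ?sgt// (ltn_trans pq).
Qed.

Lemma diagonal_interiorE p q z : p != q ->
  chord [set p; q]%SET z <->
  exists t : R, 0 < t < 1 /\ z = (1 - t) *: V p + t *: V q.
Proof.
move=> pq; split=> [[i [j [t [E ij t01 ->]]]]|[t [t01 ->]]]; last first.
  by exists p, q, t.
have pin : p \in [set i; j]%SET by rewrite -E !inE eqxx.
have qin : q \in [set i; j]%SET by rewrite -E !inE eqxx orbT.
move: pin qin pq; rewrite !inE => /orP[]/eqP-> /orP[]/eqP->; rewrite ?eqxx// => _.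
  by exists t.
exists (1 - t); split; first by apply/andP; split; move/andP: t01 => []; lra.
by rewrite addrC; congr (_ *: _ + _); ring.
Qed.

Lemma orient_chord p q r : (p < q)%N ->
  [\/ (p < r < q)%N /\ orient (V p) (V q) (V r) < 0,
      (r = p \/ r = q) /\ orient (V p) (V q) (V r) = 0 |
      (r < p)%N || (q < r)%N /\ 0 < orient (V p) (V q) (V r)].
Proof.
move=> pq; have [rp|pr|/val_inj rp] := ssrnat.ltngtP r p.
- by apply: Or33; split=> //; rewrite orient_rot orient_gt0// rp.
- have [rq|qr|/val_inj rq] := ssrnat.ltngtP r q.
  + by apply: Or31; split=> //; rewrite orient_swap oppr_lt0 orient_gt0// pr.
  + by apply: Or33; split; rewrite ?orbT// orient_gt0// pq.
  + by apply: Or32; rewrite rq orientxyy; split; [right|].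
- by apply: Or32; rewrite rp orientxyx; split; [left|].
Qed.

Lemma interleave_meet p q r s : (p < r < q)%N -> (q < s)%N ->
  chord [set p; q]%SET `&` chord [set r; s]%SET !=set0.
Proof.
move=> /andP[pr rq] qs; have pq := ltn_trans pr rq; have rs := ltn_trans rq qs.
have [|||| t [t' [t01 t'01 E]]] := @segments_meet R (V p) (V q) (V r) (V s).
- by rewrite orient_gt0// pr.
- by rewrite orient_gt0// pq.
- by rewrite orient_rot orient_gt0// pr.
- by rewrite orient_gt0// rq.
exists ((1 - t) *: V p + t *: V q); split.
  by apply/diagonal_interiorE; [rewrite neq_ltn pq|exists t].
by apply/diagonal_interiorE; [rewrite neq_ltn rs|exists t'].
Qed.

(** When the endpoints do not alternate, the line through one diagonal has the
    other one weakly on one side, and not both of its endpoints on the line. *)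
Lemma diagonals_disjoint p q r s : (p < q)%N -> (r < s)%N ->
  ~ (p = r /\ q = s) ->
  chord [set p; q]%SET `&` chord [set r; s]%SET = set0
  <-> ~~ interleave p q r s.
Proof.
move=> pq rs ne; split=> [E|ni].
  apply/negP => /orP[/and3P[pr rq qs]|/and3P[rp ps sq]].
    by have := @interleave_meet p q r s; rewrite E pr rq qs => /(_ isT isT)[].
  by have := @interleave_meet r s p q; rewrite setIC E rp ps sq => /(_ isT isT)[].
apply/seteqP; split=> // z [].
have pq' : p != q by rewrite neq_ltn pq.
have rs' : r != s by rewrite neq_ltn rs.
move=> /(diagonal_interiorE _ pq')[t [t01 zE]] /(diagonal_interiorE _ rs')[t' [/andP[t0 t1] zE']].
have : orient (V p) (V q) z = 0 by rewrite zE orient_affine orientxyx orientxyy; ring.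
rewrite zE' orient_affine.
have u0 : 0 < 1 - t' by lra.
case: (orient_chord r pq) (orient_chord s pq) => [] [hr fr] [] [hs fs].
- by nra.
- by nra.
- by move: ni; rewrite /interleave; lia.
- by nra.
- case: ne; move: rs; case: hr hs => -> [] ->; rewrite ?ltnn// => qp.
  by have := ltn_trans pq qp; rewrite ltnn.
- by nra.
- by move: ni; rewrite /interleave; lia.
- by nra.
- by nra.
Qed.

End Polygon.

(** * Facet labels as arcs and diameters *)

Section Labels.

Variable n : nat.
Hypothesis n2 : (2 <= n)%N.

Local Notation point := 'I_n.*2.
Implicit Types (x y : point) (A : {set point}).

Lemma set2_inj (T : finType) (a b c d : T) : [set a; b]%SET = [set c; d]%SET ->
  (a = c /\ b = d) \/ (a = d /\ b = c).
Proof.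
move=> E; have ain : a \in [set c; d]%SET by rewrite -E !inE eqxx.
have bin : b \in [set c; d]%SET by rewrite -E !inE eqxx orbT.
have cin : c \in [set a; b]%SET by rewrite E !inE eqxx.
have din : d \in [set a; b]%SET by rewrite E !inE eqxx orbT.
move: cin din; case/set2P: ain => ->; case/set2P: bin => ->; try by auto.
  by move=> _ /set2P[]->; auto.
by move=> /set2P[]->; auto.
Qed.

Lemma points_gt0 : (0 < n.*2)%N. Proof. by rewrite double_gt0; lia. Qed.

Definition pt (k : nat) : point := Ordinal (ltn_pmod k points_gt0).

Lemma ptE k : (k < n.*2)%N -> pt k = k :> nat.
Proof. exact: modn_small. Qed.

Lemma pt_val x : pt x = x.
Proof. by apply: val_inj; rewrite /= modn_small. Qed.

Lemma val_antipode x : antipode x = (if x < n then x + n else x - n)%N :> nat.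
Proof.
have it k : iter k (@ordS n.*2) x = ((x + k) %% n.*2)%N :> nat.
  elim: k => [|k IH]; first by rewrite addn0 modn_small.
  by rewrite iterS /= IH -addn1 modnDml addn1 addnS.
rewrite /antipode it; have := ltn_ord x => xn.
case: ifP => h; first by rewrite modn_small; lia.
have -> : (x + n = x - n + n.*2)%N by lia.
by rewrite modnDr modn_small; lia.
Qed.

Lemma antipode_pt k : (k < n.*2)%N ->
  antipode (pt k) = pt (if k < n then k + n else k - n)%N.
Proof.
move=> kn; apply/val_inj; rewrite [LHS]val_antipode ptE// [RHS]ptE//.
by case: ifP; lia.
Qed.

Lemma antipodeK : involutive (@antipode n).
Proof.
move=> x; apply/val_inj => /=; rewrite !val_antipode; have := ltn_ord x.
by do 2 case: ifP; lia.
Qed.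

Lemma central_image2 x y :
  central_image [set x; y]%SET = [set antipode x; antipode y]%SET.
Proof. by rewrite /central_image imsetU !imset_set1. Qed.

Lemma central_imageK : involutive (@central_image n).
Proof.
move=> A; rewrite /central_image -imset_comp -[RHS]imset_id.
by apply: eq_imset => x /=; rewrite antipodeK.
Qed.

Lemma diagonals2 x y : (x < y)%N ->
  ([set x; y]%SET \in diagonals n) = (2 <= y - x <= n.*2 - 2)%N.
Proof.
move=> xy; have := ltn_ord y => yn; rewrite inE cards2 neq_ltn xy /=.
apply/idP/idP => [/existsPn h|h].
  have hx := h x; have hy := h y.
  apply/andP; split; rewrite leqNgt; apply/negP => d.
    case/negP: hx; apply/eqP; congr [set _; _]%SET; apply/val_inj => /=.
    by rewrite modn_small; lia.
  case/negP: hy; rewrite finset.setUC; apply/eqP; congr [set _; _]%SET.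
  apply/val_inj => /=; have -> : y.+1 = n.*2 by lia.
  by rewrite modnn; lia.
apply/existsPn => i; apply/negP => /eqP/set2_inj E.
have iE : (i.+1 %% n.*2)%N = (if i.+1 < n.*2 then i.+1 else 0)%N.
  have lt := ltn_ord i; have [/modn_small//|ge] := ltnP.
  suff -> : i.+1 = n.*2 by rewrite modnn.
  by apply/eqP; rewrite eqn_leq ge lt.
by case: E h xy => -[-> ->] /=; rewrite iE; have := ltn_ord i; case: ifP; lia.
Qed.

Lemma diameters2 x y : (x < y)%N ->
  ([set x; y]%SET \in diameters n) = (y == x + n :> nat)%N.
Proof.
move=> xy; have := ltn_ord y => yn; rewrite inE diagonals2//.
apply/andP/eqP => [[_ /existsP[i /eqP/set2_inj[[E E']|[E E']]]]|E].
- move: xy yn; rewrite E E' val_antipode; have := ltn_ord i; case: ifP; lia.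
- move: xy yn; rewrite E E' val_antipode; have := ltn_ord i; case: ifP; lia.
split; first by rewrite E; lia.
apply/existsP; exists x; apply/eqP; congr [set _; _]%SET; apply/val_inj => /=.
by rewrite val_antipode E; case: ifP; lia.
Qed.

Lemma diagonalsP A : A \in diagonals n -> exists x y, (x < y)%N /\ A = [set x; y]%SET.
Proof.
rewrite inE => /andP[/cards2P[x [y [xy AE]]] _]; rewrite AE.
have [lt|gt|/val_inj E] := ssrnat.ltngtP x y; last by rewrite E eqxx in xy.
  by exists x, y.
by exists y, x; rewrite finset.setUC.
Qed.

Definition arc_diagonal (a : cyc_arc n) : {set point} :=
  [set pt a.1; pt (a.1 + a.2.+2)]%SET.

Definition arc_orbit (a : cyc_arc n) : {set {set point}} :=
  [set arc_diagonal a; central_image (arc_diagonal a)]%SET.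

Definition diameter (i : 'I_n) : {set point} := [set pt i; pt (i + n)]%SET.

Lemma arc_bounds (a : cyc_arc n) : (a.1 + a.2.+2 < a.1 + n)%N /\ (a.1 < n)%N.
Proof. by have := ltn_ord a.1; have := ltn_ord a.2; lia. Qed.

Lemma arc_orbit_Diag a : arc_orbit a \in Diag n.
Proof.
apply/imsetP; exists (arc_diagonal a) => //; have [h1 h2] := arc_bounds a.
have lt : (pt a.1 < pt (a.1 + a.2.+2))%N by rewrite !ptE; lia.
by rewrite inE diameters2// diagonals2// !ptE; lia.
Qed.

Lemma diameter_diameters i : diameter i \in diameters n.
Proof.
have := ltn_ord i => lin; rewrite diameters2 !ptE; lia.
Qed.

Definition to_Dlabel (x : label n) : Dlabel n :=
  match x with
  | inl a => inl (exist _ (arc_orbit a) (arc_orbit_Diag a))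
  | inr (i, c) => inr (exist _ (diameter i) (diameter_diameters i), c)
  end.

Lemma central_arc a : central_image (arc_diagonal a) =
  (if (a.1 + a.2.+2 < n)%N then [set pt (a.1 + n); pt (a.1 + a.2.+2 + n)]
   else [set pt (a.1 + a.2.+2 - n); pt (a.1 + n)])%SET.
Proof.
have [h1 h2] := arc_bounds a.
rewrite central_image2 !antipode_pt; try lia.
by rewrite h2; case: ifP => // _; rewrite finset.setUC.
Qed.

Lemma to_Dlabel_inj : injective to_Dlabel.
Proof.
move=> [a|[i c]] [a'|[i' c']] //= => [[E]|[E] <-].
  have [h1 h2] := arc_bounds a; have [h1' h2'] := arc_bounds a'.
  suff [E1 E2] : a.1 = a'.1 :> nat /\ a.2 = a'.2 :> nat.
    by congr inl; rewrite [a]surjective_pairing [a']surjective_pairing (val_inj E1) (val_inj E2).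
  case: (set2_inj E) => -[].
    by move=> /set2_inj[] [] /(congr1 val) + /(congr1 val); rewrite /= !modn_small; lia.
  rewrite [in X in X -> _]central_arc; case: ifP => h.
    by move=> /set2_inj[] [] /(congr1 val) + /(congr1 val); rewrite /= !modn_small; lia.
  by move=> /set2_inj[] [] /(congr1 val) + /(congr1 val); rewrite /= !modn_small; lia.
have := ltn_ord i; have := ltn_ord i' => hi' hi.
congr (inr (_, _)); apply/val_inj => /=.
by case/set2_inj: E => -[] /(congr1 val) + /(congr1 val); rewrite /= !modn_small; lia.
Qed.

(** A diagonal from [x] to [y], with [x < y], spans [y - x] sides, or
    [2n - (y - x)] when seen from the other side.  One of these numbers is smaller
    than [n], and the diagonal or its central image starts at a vertex below
    [n]. *)
Lemma to_Dlabel_surj d : exists l, to_Dlabel l = d.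
Proof.
case: d => [[p pD]|[[d dD] c]].
  have /imsetP[A] := pD; rewrite inE => /andP[Adiam Adiag] pE.
  suff [a [aA|aA]] : exists a, arc_diagonal a = A \/ arc_diagonal a = central_image A.
  - by exists (inl a); congr inl; apply/val_inj; rewrite /= pE /arc_orbit aA.
  - exists (inl a); congr inl; apply/val_inj; rewrite /= pE /arc_orbit aA.
    by rewrite central_imageK finset.setUC.
  have [x [y [xy AE]]] := diagonalsP Adiag; subst A.
  move: Adiam Adiag; rewrite diameters2// diagonals2// => /eqP yxn /andP[d2 d2n].
  have mk (i l : nat) : (i < n)%N -> (2 <= l < n)%N ->
      exists a : cyc_arc n, arc_diagonal a = [set pt i; pt (i + l)]%SET.
    move=> lin /andP[l2 ln]; have ln2 : (l - 2 < n - 2)%N by lia.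
    exists (Ordinal lin, Ordinal ln2); rewrite /arc_diagonal /=.
    by have -> : (l - 2).+2 = l by lia.
  have xlt := ltn_ord x; have ylt := ltn_ord y.
  have [lt|ge] := ltnP (y - x) n.
    have [xn|xn] := ltnP x n.
      have [||a aE] := mk x (y - x)%N => //; first by rewrite d2.
      by exists a; left; rewrite aE subnKC ?(ltnW xy)// !pt_val.
    have [||a aE] := mk (x - n)%N (y - x)%N; [lia|lia|].
    exists a; right; rewrite aE central_image2.
    rewrite -[x]pt_val -[y]pt_val !antipode_pt//.
    by congr [set pt _; pt _]%SET; rewrite /= !modn_small//; case: ifP; lia.
  have [||a aE] := mk (y - n)%N (n.*2 - (y - x))%N; [lia|lia|].
  exists a; right; rewrite aE central_image2 finset.setUC.
  rewrite -[x]pt_val -[y]pt_val !antipode_pt//.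
  by congr [set pt _; pt _]%SET; rewrite /= !modn_small//; case: ifP; lia.
have /diagonalsP[x [y [xy dE]]] : d \in diagonals n by move: dD; rewrite inE => /andP[].
have yx : (y = x + n :> nat)%N by apply/eqP; rewrite -diameters2// -dE.
have ylt := ltn_ord y; have xn : (x < n)%N by lia.
exists (inr (Ordinal xn, c)); congr (inr (_, _)); apply/val_inj; rewrite /= dE.
by congr [set _; _]%SET; rewrite /= -?yx pt_val.
Qed.

Section Compatibility.

Variable R : realType.

Local Notation chord := (@diagonal_interior R n).

Lemma chords_disjoint (p q r s : nat) :
  (p < q < n.*2)%N -> (r < s < n.*2)%N -> (p != r) || (q != s) ->
  chord [set pt p; pt q]%SET `&` chord [set pt r; pt s]%SET = set0 <->
  ~~ interleave p q r s.
Proof.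
move=> /andP[pq qn] /andP[rs sn] ne.
have := @diagonals_disjoint R n _ (pt p) (pt q) (pt r) (pt s).
rewrite !ptE; try lia; apply => //; first by lia.
by move=> [/(congr1 val) + /(congr1 val)]; rewrite /= !modn_small; lia.
Qed.

(** The four crossings between two orbits of diagonals come in two pairs of
    centrally symmetric ones; the mixed crossings [x2] and [x3] are those of an arc
    with a translate of the other one. *)
Lemma avoid_orbits (x1 x2 x3 x4 y2 y3 : bool) : x4 = x1 -> x3 = x2 -> x2 = y2 || y3 ->
  (~~ x1 /\ ~~ x2) /\ (~~ x3 /\ ~~ x4) <-> ~~ [|| x1, y2 | y3].
Proof. by move=> -> -> ->; case: x1; case: y2; case: y3; split=> // -[[]]. Qed.

Lemma arcs_compatible a a' : a != a' ->
  Dcompatible R (to_Dlabel (inl a)) (to_Dlabel (inl a')) <->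
  ~~ arcs_cross n a.1 a.2.+2 a'.1 a'.2.+2.
Proof.
move=> aa'; have [h1 h2] := arc_bounds a; have [h1' h2'] := arc_bounds a'.
have ne : (a.1 != a'.1 :> nat) || (a.2 != a'.2 :> nat).
  by move: aa'; rewrite -negb_and; apply: contra; case: a a' {h1 h2 h1' h2'} =>
    [i k] [i' k'] /= /andP[/eqP/val_inj-> /eqP/val_inj->].
have -> : Dcompatible R (to_Dlabel (inl a)) (to_Dlabel (inl a')) <->
    (chord (arc_diagonal a) `&` chord (arc_diagonal a') = set0 /\
     chord (arc_diagonal a) `&` chord (central_image (arc_diagonal a')) = set0) /\
    (chord (central_image (arc_diagonal a)) `&` chord (arc_diagonal a') = set0 /\
     chord (central_image (arc_diagonal a)) `&` chord (central_image (arc_diagonal a')) = set0).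
  split=> [[[_ h]|[d [e [c []]]]|[d [c [c' []]]]]//|[[c1 c2] [c3 c4]]].
    by do !split; apply: h; rewrite !inE eqxx ?orbT.
  by apply: Or31; split=> // A B; rewrite !inE => /orP[]/eqP-> /orP[]/eqP->.
rewrite !central_arc /arc_diagonal; move: h1 h2 h1' h2' ne.
move: (nat_of_ord a.1) (nat_of_ord a.2) (nat_of_ord a'.1) (nat_of_ord a'.2).
move=> i k j m h1 h2 h1' h2' ne; case: ifP => h; case: ifP => h';
rewrite !chords_disjoint; try lia;
by apply: avoid_orbits; rewrite /interleave; lia.
Qed.

Lemma arc_diameter_compatible a i c :
  (Dcompatible R (to_Dlabel (inl a)) (to_Dlabel (inr (i, c))) <-> ~~ arc_over n a.1 a.2.+2 i) *
  (Dcompatible R (to_Dlabel (inr (i, c))) (to_Dlabel (inl a)) <-> ~~ arc_over n a.1 a.2.+2 i).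
Proof.
have [h1 h2] := arc_bounds a; have hi := ltn_ord i.
have E : (chord (arc_diagonal a) `&` chord (diameter i) = set0 /\
    chord (central_image (arc_diagonal a)) `&` chord (diameter i) = set0) <->
    ~~ arc_over n a.1 a.2.+2 i.
  rewrite central_arc /arc_diagonal /diameter; case: ifP => h;
  rewrite !chords_disjoint; try lia;
  by rewrite /arc_over /interleave; split=> [[]|h0]; [|split]; lia.
split; rewrite -E.
- split=> [[[_ h]|[d [e [c' []]]]|[d [c1 [c2 []]]]]//|[c1 c2]].
    by split; apply: h; rewrite !inE eqxx ?orbT.
  by apply: Or31; split=> // A B; rewrite !inE => /orP[]/eqP-> /eqP->.
- split=> [[[_ h]|[d [e [c' []]]]|[d [c1 [c2 []]]]]//|[c1 c2]].
    by split; rewrite setIC; apply: h; rewrite !inE eqxx ?orbT.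
  by apply: Or31; split=> // A B; rewrite !inE => /eqP-> /orP[]/eqP->; rewrite setIC.
Qed.

Lemma joined_setT (i j : 'I_n) : joined [set: cyc_arc n]%SET i j = (i == j).
Proof.
have := ltn_ord i; have := ltn_ord j => hj hi.
apply/andP/eqP => [[g1 /existsPn h]|<-]; last first.
  have g0 : gap n i i = 0%N by rewrite /gap leqnn subnn.
  by rewrite g0; split=> //; apply/existsPn => k; rewrite andbF.
have gn : (gap n i j < n)%N by rewrite /gap; case: ifP; lia.
have [g2|g2] := leqP 2 (gap n i j).
  have kP : (gap n i j - 2 < n - 2)%N by lia.
  by have := h (Ordinal kP); rewrite inE /=; lia.
have : gap n i j = 0%N by lia.
by rewrite /gap => g0; apply/val_inj => /=; move: g0; case: ifP; lia.
Qed.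

Lemma diameters_compatible i j (c c' : bool) :
  Dcompatible R (to_Dlabel (inr (i, c))) (to_Dlabel (inr (j, c'))) <-> (c == c') || (i == j).
Proof.
split=> [[[//]|[d [e [c0 [[_ ->] [_ ->]]]]]|[d [c1 [c2 [[E1 _] [E2 _] _]]]]]|].
- by rewrite eqxx.
- apply/orP; right.
  have := @to_Dlabel_inj (inr (i, c)) (inr (j, c)); rewrite /= .
  by rewrite E1 E2 => /(_ erefl)[->].
case/orP => [/eqP->|/eqP->].
  by apply: Or32; do 3 eexists.
have [->|cc'] := eqVneq c c'; first by apply: Or32; do 3 eexists.
by apply: Or33; do 3 eexists; split.
Qed.

Lemma to_Dlabel_compatible l l' : l != l' ->
  Dcompatible R (to_Dlabel l) (to_Dlabel l') <-> label_adj [set: cyc_arc n]%SET l l'.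
Proof.
case: l l' => [a|[i c]] [a'|[j c']] xy.
- case: a a' xy => [i k] [i' k'] xy; apply: (@arcs_compatible (i, k) (i', k')).
  by apply: contraNneq xy => ->.
- by case: a xy => i k _; exact: (arc_diameter_compatible (i, k) j c').1.
- case: a' xy => i' k _; rewrite (arc_diameter_compatible (i', k) i c).2.
  by case: c.
- rewrite diameters_compatible /=.
  by case: c c' {xy} => [] [] //=; rewrite joined_setT// eq_sym.
Qed.

End Compatibility.

End Labels.

(** * The generalized associahedron is a shaved cube *)

Theorem theorem2 (R : realType) (n : nat) (hn : (2 <= n)%N) :
  (exists P : set 'rV[R]_n, assoc_D P) /\
  (forall P : set 'rV[R]_n, assoc_D P -> Pcube P).
Proof.
have [|Q [shQ [A [b]]]] := @shaved_label_adj n hn R [set: cyc_arc n]%SET.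
  by move=> *; rewrite inE.
have -> : present [set: cyc_arc n]%SET = [set: label n]%SET.
  by apply/setP => -[a|a]; rewrite !inE.
move=> rQ; pose L := to_Dlabel hn.
have Ladj l l' : l != l' -> Dcompatible R (L l) (L l') <-> label_adj [set: cyc_arc n]%SET l l'.
  exact: to_Dlabel_compatible.
(* Any realization of [D^n] has the same graph as the shaved cube [Q]. *)
split; last first.
  move=> P [flagP [phi [[phiF phiI phiS] phiadj]]].
  have [||||A' [b' rP]] := @flag_realizes R n (label n)
    (label_adj [set: cyc_arc n]%SET) P (phi \o L).
  - exact: ltnW.
  - exact: flagP.
  - split=> [l _|l l' _ _ /=|F /phiS[d _ <-]]; first exact: phiF.
      by move=> /phiI E; apply/(@to_Dlabel_inj n hn)/E; rewrite inE.
    by have [l <-] := to_Dlabel_surj hn d; exists l.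
  - move=> l l' ll'; rewrite -Ladj//; apply: phiadj => /to_Dlabel_inj E.
    by rewrite E eqxx in ll'.
  split; first exact: realizes_polytope rP.
  by exists Q; split=> //; exact: realizes_comb_equiv rP rQ.
(* The shaved cube [Q] is itself a realization of [D^n]. *)
have /choice[g gK] := to_Dlabel_surj hn; rewrite -/L in gK.
have LK l : g (L l) = l by apply: (@to_Dlabel_inj n hn); exact: gK.
exists Q; split; first by apply: (realizes_flag rQ) => k l; exact: label_adj_sym.
exists (fun d => Hface [set: label n]%SET A b [set g d]%SET); split.
  split=> [d _|d d' _ _|F /(realizes_facetP rQ)[l _ ->]].
  - by apply/(realizes_facetP rQ); exists (g d); rewrite ?inE.
  - by move=> /(realizes_facet_inj rQ) E; rewrite -[d]gK -[d']gK E// inE.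
  - by exists (L l); rewrite ?LK.
move=> d d' dd'; have gg : g d != g d'.
  by apply: contra_notN dd' => /eqP E; rewrite -[d]gK -[d']gK E.
rewrite (realizes_adj rQ) ?inE//; last by move=> k l; exact: label_adj_sym.
by rewrite -Ladj// !gK.
Qed.
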